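(* Let $1\le d^*\le d$ and $n\ge 1$ be integers and let $(\boldsymbol X_i,Y_i)$, $i=1,\dots,n$, be i.i.d. pairs obeying $Y_i=f(\boldsymbol X_i)+\sigma\varepsilon_i$, where $\boldsymbol X_i$ has density $g$ on $\mathbb R^d$. Suppose that conditions [C1], [C2$(\kappa,L)$], [C3$(L_\infty,L_2)$] and [C4] (stated in the context) hold with known constants $g_{\min},L,\kappa,L_2$, and that the design density $g$ and (an upper estimate of) the noise magnitude $\sigma$ are available; let $J$ be the sparsity pattern of $f$. Set $$m=\Big(\frac{2Ld^*}{\kappa}\Big)^{1/2},\qquad \lambda=4(\sigma+L_2)\Big(\frac{d^*\log(6md)}{n\,g_{\min}^2}\Big)^{1/2}.$$ If $$\frac{L_\infty^2 d^*\log(6md)}{n}\le L_2^2\qquad\text{and}\qquad \frac{128(\sigma+L_2)^2 d^* N(d^*,2L/\kappa)\log(6md)}{n\,g_{\min}^2}\le\kappa ,$$ then the estimator $\widehat J_n(m,\lambda)$ defined in the context satisfies $$\mathbf P\big(\widehat J_n(m,\lambda)\ne J\big)\le 3(6md)^{-d^*}.$$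
   Context: Fourier basis on $[0,1]^d$: for $\boldsymbol k\in\mathbb Z^d$, $\varphi_{\boldsymbol k}(\boldsymbol x)=1$ if $\boldsymbol k=0$; $\varphi_{\boldsymbol k}(\boldsymbol x)=\sqrt2\cos(2\pi \boldsymbol k\cdot\boldsymbol x)$ if $\boldsymbol k\in(\mathbb Z^d)_+$; $\varphi_{\boldsymbol k}(\boldsymbol x)=\sqrt2\sin(2\pi \boldsymbol k\cdot\boldsymbol x)$ if $-\boldsymbol k\in(\mathbb Z^d)_+$, where $(\mathbb Z^d)_+$ is the set of $\boldsymbol k\in\mathbb Z^d\setminus\{0\}$ whose first nonzero coordinate is positive. For a function $f$ put $\theta_{\boldsymbol k}[f]=\int_{[0,1]^d}f(\boldsymbol x)\varphi_{\boldsymbol k}(\boldsymbol x)\,d\boldsymbol x$ and $Q_j[f]=\sum_{\boldsymbol k\in\mathbb Z^d:\,k_j\ne0}\theta_{\boldsymbol k}[f]^2$, and let $$\Sigma_L=\Big\{f:\ \sum_{\boldsymbol k\in\mathbb Z^d}k_j^2\,\theta_{\boldsymbol k}[f]^2\le L\ \ \forall j\in\{1,\dots,d\}\Big\}.$$ The noise magnitude is $\sigma\ge0$, the noise satisfies $\mathbf E[\varepsilon_i|\boldsymbol X_i]=0$, and $P_X$ denotes the distribution of $\boldsymbol X_i$, with Lebesgue density $g$. Conditions: - [C1] $g(\boldsymbol x)=0$ for $\boldsymbol x\notin[0,1]^d$ and $g(\boldsymbol x)\ge g_{\min}$ for $\boldsymbol x\in[0,1]^d$, where $g_{\min}>0$.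 - [C2$(\kappa,L)$] ($\kappa,L>0$) $f\in\Sigma_L$, and for some $J\subset\{1,\dots,d\}$ of cardinality $\le d^*$ there is a function $\bar f:\mathbb R^{|J|}\to\mathbb R$ with $f(\boldsymbol x)=\bar f(\boldsymbol x_J)$ for all $\boldsymbol x\in\mathbb R^d$ (where $\boldsymbol x_J=(x_j)_{j\in J}$), and $Q_j[f]\ge\kappa$ for all $j\in J$. The set $J$ is called the sparsity pattern of $f$. - [C3$(L_\infty,L_2)$] $P_X(\{\boldsymbol x\in[0,1]^d:|f(\boldsymbol x)|\le L_\infty\})=1$ with $L_\infty>0$, and $\int_{[0,1]^d}f(\boldsymbol x)^2g(\boldsymbol x)\,d\boldsymbol x\le L_2^2$. - [C4] Almost surely, $\mathbf E[e^{t\varepsilon_i}|\boldsymbol X_i]\le e^{t^2/2}$ for all $t\in\mathbb R$. Lattice-point count: $N(d^*,\gamma)$ is the cardinality of $\{\boldsymbol k\in\mathbb Z^{d^*}:\ \|\boldsymbol k\|_2^2\le\gamma d^*,\ k_1\ne0\}$. Estimator: let $\widehat\theta_{\boldsymbol k}=\frac1n\sum_{i=1}^n\frac{\varphi_{\boldsymbol k}(\boldsymbol X_i)}{g(\boldsymbol X_i)}Y_i$ and $S_{m,\ell}=\{\boldsymbol k\in\mathbb Z^d:\ \|\boldsymbol k\|_2\le m,\ \|\boldsymbol k\|_0\le\ell\}$, where $\|\boldsymbol k\|_0$ is the number of nonzero coordinates of $\boldsymbol k$. Then $$\widehat J_n(m,\lambda)=\Big\{j\in\{1,\dots,d\}:\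 \max_{\boldsymbol k\in S_{m,d^*}:\,k_j\ne0}|\widehat\theta_{\boldsymbol k}|>\lambda\Big\}$$ (i.e. $j$ is selected iff some $\boldsymbol k\in S_{m,d^*}$ with $k_j\neq 0$ has $|\widehat\theta_{\boldsymbol k}|>\lambda$). *)

(* Defs.v *)
From HB Require Import structures.
From mathcomp Require Import all_boot all_order all_algebra finmap.
From mathcomp Require Import all_classical all_reals all_analysis.
Set Implicit Arguments.
Unset Strict Implicit.
Unset Printing Implicit Defensive.
Import Order.TTheory GRing.Theory Num.Theory.
Import numFieldNormedType.Exports.
Local Open Scope classical_set_scope.
Local Open Scope ring_scope.

(* R^d is d.-tuple R with the product sigma-algebra, and Z^d is d.-tuple int. *)

Section lebesgue_step.
Context {R : realType} {n : nat}.
Variable mu : {sigma_finite_measure set (n.-tuple R) -> \bar R}.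

Definition tcons (p : measurableTypeR R * n.-tuple R) : n.+1.-tuple R :=
  [tuple of (p.1 : R) :: p.2].

Definition tuncons (t : n.+1.-tuple R) : measurableTypeR R * n.-tuple R :=
  (thead t, [tuple of behead t]).

Lemma tconsK : cancel tcons tuncons.
Proof. by case=> x t; congr pair; apply/val_inj. Qed.

Lemma tunconsK : cancel tuncons tcons.
Proof. by move=> t; rewrite /tcons /= -tuple_eta. Qed.

Lemma measurable_tcons :
  measurable_fun [set: measurableTypeR R * n.-tuple R] tcons.
Proof.
by apply: measurable_cons; [exact: measurable_fst|exact: measurable_snd].
Qed.

Lemma measurable_tuncons : measurable_fun [set: n.+1.-tuple R] tuncons.
Proof.
apply/measurable_fun_pairP; split; last exact: measurable_behead.
exact: (@measurable_tnth _ R n.+1 ord0).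
Qed.

Definition lebesgue_step : set (n.+1.-tuple R) -> \bar R :=
  pushforward (@lebesgue_measure R \x mu)%E tcons.

Let mpre A : measurable A -> measurable (tcons @^-1` A).
Proof.
by move=> mA; rewrite -[X in measurable X]setTI; exact: measurable_tcons.
Qed.

Let lebesgue_step0 : lebesgue_step set0 = 0%E.
Proof. by rewrite /lebesgue_step /pushforward preimage_set0 measure0. Qed.

Let lebesgue_step_ge0 A : (0 <= lebesgue_step A)%E.
Proof. by rewrite /lebesgue_step /pushforward measure_ge0. Qed.

Let lebesgue_step_sigma_additive : semi_sigma_additive lebesgue_step.
Proof.
move=> F mF tF mUF; rewrite /lebesgue_step /pushforward preimage_bigcup.
apply: measure_semi_sigma_additive.
- by move=> i; exact: mpre.
- apply/trivIsetP => /= i j _ _ ij; rewrite -preimage_setI.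
  by move/trivIsetP : tF => /(_ _ _ _ _ ij) ->//; rewrite preimage_set0.
- by rewrite -preimage_bigcup; exact: mpre.
Qed.

HB.instance Definition _ := isMeasure.Build _ _ _ lebesgue_step
  lebesgue_step0 lebesgue_step_ge0 lebesgue_step_sigma_additive.

Let lebesgue_step_sigma_finite : sigma_finite setT lebesgue_step.
Proof.
have /sigma_finiteP[F [TF ndF Foo]] := sigma_finiteT (@lebesgue_measure R).
have /sigma_finiteP[G [TG ndG Goo]] := sigma_finiteT mu.
exists (fun i => tuncons @^-1` (F i `*` G i)).
  rewrite -preimage_bigcup (_ : \bigcup_i _ = setT) ?preimage_setT//.
  apply/seteqP; split=> // -[x t] _.
  have [i _ Fix] : (\bigcup_i F i) x by rewrite -TF.
  have [j _ Gjt] : (\bigcup_i G i) t by rewrite -TG.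
  exists (maxn i j) => //; split=> /=.
    by move: x Fix; exact/subsetPset/ndF/leq_maxl.
  by move: t Gjt; exact/subsetPset/ndG/leq_maxr.
move=> i; have [mF Fi] := Foo i; have [mG Gi] := Goo i.
have mFG := measurableX mF mG; split.
  by rewrite -[X in measurable X]setTI; exact: measurable_tuncons.
rewrite /lebesgue_step /pushforward.
rewrite (_ : tcons @^-1` _ = F i `*` G i); last first.
  rewrite -comp_preimage (_ : tuncons \o tcons = id) ?preimage_id//.
  by apply/funext => p; exact: tconsK.
by rewrite product_measure1E// lte_mul_pinfty// ge0_fin_numE.
Qed.

HB.instance Definition _ := Measure_isSigmaFinite.Build _ _ _ lebesgue_step
  lebesgue_step_sigma_finite.

End lebesgue_step.

Fixpoint lebesgue_tuple (R : realType) (d : nat) :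
    {sigma_finite_measure set (d.-tuple R) -> \bar R} :=
  match d with
  | 0 => dirac [tuple]
  | d'.+1 => lebesgue_step (lebesgue_tuple R d')
  end.

Lemma lebesgue_tuple_box (R : realType) (d : nat) (A : 'I_d -> set R) :
  (forall i, measurable (A i)) ->
  lebesgue_tuple R d [set x | forall i, A i (tnth x i)] =
  (\prod_(i < d) @lebesgue_measure R (A i))%E.
Proof.
elim: d A => [|d IHd] A mA.
  rewrite big_ord0 /= diracE mem_set//=; by case.
rewrite big_ord_recl -IHd; last by move=> i.
rewrite /= /lebesgue_step /pushforward.
rewrite -[RHS]product_measure1E; first 1 last.
- exact: mA.
- rewrite (_ : [set x | _] = \bigcap_(i in [set: 'I_d])
      ((fun x : d.-tuple R => tnth x i) @^-1` A (lift ord0 i))); last first.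
    by apply/seteqP; split=> x /= Ax i => [_|]; exact: Ax.
  apply: fin_bigcap_measurable => [|i _]; first exact: finite_finset.
  rewrite -[X in measurable X]setTI; apply: measurable_tnth => //.
congr (_ _); apply/seteqP; split=> -[x t] /=.
  move=> Axt; split=> [|i]; first by have := Axt ord0; rewrite tnth0.
  by have := Axt (lift ord0 i); rewrite tnthS.
move=> [Ax At] i; have [j ->|->] := unliftP ord0 i; last by rewrite tnth0.
by rewrite tnthS; exact: At.
Qed.

Definition unit_cube (R : realType) (d : nat) : set (d.-tuple R) :=
  [set x | forall i, 0 <= tnth x i <= 1].
Arguments unit_cube : clear implicits.

Section fourier.
Context {R : realType} {d : nat}.
Implicit Types (k : d.-tuple int) (x : d.-tuple R) (f : d.-tuple R -> R).

Definition zpos k : bool :=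
  [exists i, (0 < tnth k i) && [forall j : 'I_d, (j < i)%N ==> (tnth k j == 0)]].

Definition dotz k x : R := \sum_(i < d) (tnth k i)%:~R * tnth x i.

Definition phi k x : R :=
  if [forall i, tnth k i == 0] then 1
  else if zpos k then Num.sqrt 2 * cos (2 * pi * dotz k x)
  else Num.sqrt 2 * sin (2 * pi * dotz k x).

Definition theta f k : R :=
  \int[lebesgue_tuple R d]_(x in unit_cube R d) (f x * phi k x).

Definition Qj f (j : 'I_d) : \bar R :=
  \esum_(k in [set k : d.-tuple int | tnth k j != 0]) (theta f k ^+ 2)%:E.

Definition Sigma_class (L : R) f : Prop := forall j : 'I_d,
  (\esum_(k in [set: d.-tuple int]) ((tnth k j)%:~R ^+ 2 * theta f k ^+ 2)%:E
     <= L%:E)%E.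

Definition norm2 k : R := Num.sqrt (\sum_(i < d) (tnth k i)%:~R ^+ 2).

Definition norm0 k : nat := #|[set i | tnth k i != 0]|.

Definition subtuple (J : {set 'I_d}) x : #|J|.-tuple R :=
  [tuple tnth x (enum_val i) | i < #|J|].

End fourier.

(* [fset_set] is meaningful only on finite sets, which this one is. *)
Definition lattice_count (R : realType) (dstar : nat) (gamma : R) : nat :=
  #|` fset_set [set k : dstar.-tuple int |
        norm2 (R := R) k ^+ 2 <= gamma * dstar%:R /\ head 0 k != 0] |.

Section estimator.
Context {R : realType} {d n : nat}.
Variables (g : d.-tuple R -> R) (x : 'I_n -> d.-tuple R) (y : 'I_n -> R).

Definition theta_hat (k : d.-tuple int) : R :=
  n%:R^-1 * \sum_(i < n) phi k (x i) / g (x i) * y i.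

Definition J_hat (dstar : nat) (m lambda : R) : {set 'I_d} :=
  [set j | `[< exists k : d.-tuple int,
    [/\ norm2 k <= m, (norm0 k <= dstar)%N, tnth k j != 0
      & lambda < `|theta_hat k| ] >]].

End estimator.

Section probability.
Context {disp dispU : measure_display} {T : measurableType disp}
  {U : measurableType dispU} {R : realType}.
Variable P : probability T R.

(* The product rule over every subfamily. *)
Definition mutually_independent (I : finType) (Z : I -> T -> U) : Prop :=
  forall (K : {set I}) (B : I -> set U), (forall i, measurable (B i)) ->
  P (\bigcap_(i in [set` K]) Z i @^-1` B i) =
  (\prod_(i in K) P (Z i @^-1` B i))%E.

Definition identically_distributed (I : finType) (Z : I -> T -> U) : Prop :=
  forall (i j : I) (B : set U), measurable B ->
  P (Z i @^-1` B) = P (Z j @^-1` B).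

(* [h] is a version of u |-> E[Z | X = u], i.e. [h \o X] is a version of
   E[Z | X]. *)
Definition is_cond_expectation (X : T -> U) (Z : T -> R) (h : U -> R) : Prop :=
  [/\ P.-integrable setT (EFin \o Z), measurable_fun setT h,
      P.-integrable setT (EFin \o (h \o X))
    & forall B, measurable B ->
      (\int[P]_(w in X @^-1` B) (Z w)%:E =
       \int[P]_(w in X @^-1` B) (h (X w))%:E)%E].

End probability.

Section conditions.
Context {R : realType} {d : nat}.

Definition has_density disp (T : measurableType disp) (P : probability T R)
    (X : {RV P >-> d.-tuple R}) (g : d.-tuple R -> R) : Prop :=
  [/\ measurable_fun setT g, (forall x, 0 <= g x)
    & forall A, measurable A ->
      distribution P X A = (\int[lebesgue_tuple R d]_(x in A) (g x)%:E)%E].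

Definition C1 (gmin : R) (g : d.-tuple R -> R) : Prop :=
  (forall x, ~ unit_cube R d x -> g x = 0) /\
  (forall x, unit_cube R d x -> gmin <= g x).

Definition C2 (dstar : nat) (kappa L : R) (f : d.-tuple R -> R)
    (J : {set 'I_d}) : Prop :=
  [/\ Sigma_class L f, (#|J| <= dstar)%N,
      exists fbar : #|J|.-tuple R -> R, forall x, f x = fbar (subtuple J x)
    & forall j, j \in J -> (kappa%:E <= Qj f j)%E].

Definition C3 disp (T : measurableType disp) (P : probability T R)
    (X : {RV P >-> d.-tuple R}) (Linf L2 : R) (f g : d.-tuple R -> R) : Prop :=
  distribution P X [set x | unit_cube R d x /\ `|f x| <= Linf] = 1%E /\
  (\int[lebesgue_tuple R d]_(x in unit_cube R d) (f x ^+ 2 * g x)%:E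
     <= (L2 ^+ 2)%:E)%E.

(* A single family of versions of the conditional moment generating function
   carries the bound for all t off one null set. *)
Definition C4 disp (T : measurableType disp) (P : probability T R)
    (X : {RV P >-> d.-tuple R}) (eps : {RV P >-> R}) : Prop :=
  exists2 h : R -> d.-tuple R -> R,
    forall t, is_cond_expectation P X (fun w => expR (t * eps w)) (h t)
  & {ae P, forall w, forall t, h t (X w) <= expR (t ^+ 2 / 2)}.

End conditions.

(* Main.v *)
(* Write [W_i = phi_k(X_i) / g(X_i) * Y_i], so that [theta_hat k] is the mean of
   the [W_i].  For real [s] with [|s| sqrt 2 Linf / gmin <= 3/2],
   [E exp (s W_i) <= exp (s theta_k + s^2 (sigma^2 + 2 L2^2) / gmin^2)]: the
   noise is integrated out first, the convexity of exp replacing the random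
   multiplier [phi_k(X)/g(X)] of the noise by the two constants
   [+/- sqrt 2 / gmin], and [e^u <= 1 + u + u^2] for [u <= 3/2] handles the signal.
   Chernoff's bound with [s = gmin sqrt (dstar log (6md) / n) / (sigma + L2)]
   then gives [P (|theta_hat k - theta_k| >= lambda) <= 2 (6md)^(-2 dstar)] for
   each single [k], and [S_(m,dstar)] has at most [(3md)^dstar] elements.  On the
   complementary event, [theta_k = 0] as soon as [k_j <> 0] for some irrelevant
   [j], so no irrelevant [j] is selected; and if a relevant [j] were not
   selected, all [theta_k] with [k] in [S_(m,dstar)], [k_j <> 0] would be smaller
   than [2 lambda], while frequencies beyond [m] carry at most [kappa / 2] of
   [Q_j], which contradicts [Q_j >= kappa].  When [m < 1], the estimator and the
   pattern are both empty. *)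
Require Import Defs.
From HB Require Import structures.
From mathcomp Require Import all_boot all_order all_algebra.
From mathcomp Require Import all_classical all_reals all_analysis.
From mathcomp Require Import measurable_realfun.
From mathcomp Require Import ring lra zify.
Set Implicit Arguments.
Unset Strict Implicit.
Unset Printing Implicit Defensive.
Import Order.TTheory GRing.Theory Num.Theory.
Import numFieldNormedType.Exports.
Local Open Scope classical_set_scope.
Local Open Scope ring_scope.

(** * Integrals against a weighted measure *)

Section weighted_measure.
Local Open Scope ereal_scope.
Context d (T : measurableType d) (R : realType).
Variables (mu : {measure set T -> \bar R}) (w : T -> R).
Hypotheses (w0 : forall x, (0 <= w x)%R) (mw : measurable_fun setT w).

(* The side conditions are arguments so that the measure structure can be
   inferred from the term. *)
Definition weighted_measure of (forall x, (0 <= w x)%R) & measurable_fun setT w :=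
  fun A : set T => \int[mu]_(x in A) (w x)%:E.

Local Notation nu := (weighted_measure w0 mw).

Let mEw : measurable_fun setT (EFin \o w).
Proof. exact/measurable_EFinP. Qed.

Let nu0 : nu set0 = 0.
Proof. by rewrite /weighted_measure integral_set0. Qed.

Let nu_ge0 A : 0 <= nu A.
Proof. by apply: integral_ge0 => x _; rewrite lee_fin. Qed.

Let nu_sigma_additive : semi_sigma_additive nu.
Proof. by apply: semi_sigma_additive_nng_induced => // x; rewrite lee_fin. Qed.

HB.instance Definition _ := isMeasure.Build _ _ _ nu
  nu0 nu_ge0 nu_sigma_additive.

Import HBNNSimple.

(** On the indicator of a level set this is the definition of [nu]; linearity carries it to the
    simple approximations [h n], and monotone convergence on both sides carries it to [F]. *)
Lemma integral_weighted_measure (F : T -> \bar R) :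
  (forall x, 0 <= F x) -> measurable_fun setT F ->
  \int[nu]_x F x = \int[mu]_x (F x * (w x)%:E).
Proof.
move=> F0 mF; pose h := nnsfun_approx measurableT mF.
have hF x : (EFin \o h ^~ x) @ \oo --> F x.
  by apply: cvg_nnsfun_approx.
have ndh x : {homo (fun n => (h n x)%:E) : a b / (a <= b)%N >-> a <= b}.
  by move=> a b ab; rewrite lee_fin; exact/lefP/nd_nnsfun_approx.
transitivity (limn (fun n => \int[nu]_x (h n x)%:E)).
  rewrite -monotone_convergence//.
  - by apply: eq_integral => x _; apply/esym/cvg_lim => //; exact: hF.
  - by move=> n; exact/measurable_EFinP.
  - by move=> n x _; rewrite lee_fin.
transitivity (limn (fun n => \int[mu]_x ((h n x)%:E * (w x)%:E))); last first.
  rewrite -monotone_convergence//.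
  - apply: eq_integral => x _; apply/cvg_lim => //.
    by apply: cvgeZr => //; exact: hF.
  - by move=> n; apply: emeasurable_funM => //; exact/measurable_EFinP.
  - by move=> n x _; rewrite mule_ge0// lee_fin.
  - by move=> x _ a b ab; rewrite lee_wpmul2r ?lee_fin// -lee_fin ndh.
congr (limn _); apply/funext => n.
transitivity (\int[nu]_x
   (\sum_(y \in range (h n)) (y * \1_(h n @^-1` [set y]) x)%:E)).
  by apply: eq_integral => t tE; rewrite /= fimfunE -fsumEFin.
have indich r :
    measurable_fun setT (fun x => (r * \1_(h n @^-1` [set r]) x)%:E : \bar R).
  by apply: (measurable_comp measurableT) => //; exact: measurable_funM.
rewrite ge0_integral_fsum//; last by move=> m y _; exact: nnfun_muleindic_ge0.
transitivity (\int[mu]_x (\sum_(y \in range (h n))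
    (y * \1_(h n @^-1` [set y]) x)%:E * (w x)%:E)); last first.
  apply: eq_integral => x _.
  rewrite -ge0_mule_fsuml => [|y]; last exact: nnfun_muleindic_ge0.
  by rewrite fsumEFin // -(fimfunE _ x).
rewrite ge0_integral_fsum//; last 2 first.
  - by move=> y; apply: emeasurable_funM.
  - by move=> m y _; rewrite mule_ge0// ?lee_fin// -lee_fin nnfun_muleindic_ge0.
apply: eq_fsbigr => r rhn.
under eq_integral do rewrite EFinM.
rewrite integralZl_indic_nnsfun => //.
under [RHS]eq_integral do rewrite EFinM -muleA.
rewrite ge0_integralZl//.
- under [in RHS]eq_integral do rewrite muleC.
  rewrite [in RHS](eq_integral ((EFin \o w) \_ (h n @^-1` [set r]))); last first.
    by move=> x xE; rewrite epatch_indic.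
  rewrite -integral_mkcond integral_indic//= setIT.
  by [].
- by apply: emeasurable_funM => //; exact/measurable_EFinP.
- by move=> t Et; rewrite mule_ge0 ?lee_fin.
- by move: rhn; rewrite inE => -[t _ <-]; rewrite lee_fin.
Qed.

End weighted_measure.

(** * Comparing integrals from a comparison on events *)

Section weighted_integral.
Local Open Scope ereal_scope.
Context d1 d2 (T : measurableType d1) (U : measurableType d2) (R : realType).
Variables (mu : {measure set T -> \bar R}) (nu : {measure set U -> \bar R}).
Variables (w : T -> R) (Z : T -> U).
Hypotheses (w0 : forall x, (0 <= w x)%R) (mw : measurable_fun setT w).
Hypothesis mZ : measurable_fun setT Z.

Let wint F : (forall u, 0 <= F u) -> measurable_fun setT F ->
  \int[pushforward (weighted_measure mu w0 mw) Z]_u F u =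
  \int[mu]_x (F (Z x) * (w x)%:E).
Proof.
move=> F0 mF; rewrite ge0_integral_pushforward//.
rewrite preimage_setT integral_weighted_measure//=.
exact: measurableT_comp.
Qed.

(** The hypothesis says that the image under [Z] of the measure with density [w] is dominated by [c]
    times [nu], and domination of measures passes to integrals of nonnegative functions. It turns
    information on events, such as independence or a conditional expectation, into information on
    functions. *)
Lemma weighted_integral_le (c : R) (F : U -> \bar R) : (0 <= c)%R ->
  (forall B, measurable B ->
    \int[mu]_(x in Z @^-1` B) (w x)%:E <= c%:E * nu B) ->
  (forall u, 0 <= F u) -> measurable_fun setT F ->
  \int[mu]_x (F (Z x) * (w x)%:E) <= c%:E * \int[nu]_u F u.
Proof.
move=> c0 cnu F0 mF; pose c' : {nonneg R} := NngNum c0.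
rewrite -wint// -[c]/(c'%:num)%R -ge0_integral_mscale//.
by apply: ge0_le_measure_integral => // B mB; exact: cnu.
Qed.

Lemma weighted_integral_eq (F : U -> \bar R) :
  (forall B, measurable B -> \int[mu]_(x in Z @^-1` B) (w x)%:E = nu B) ->
  (forall u, 0 <= F u) -> measurable_fun setT F ->
  \int[mu]_x (F (Z x) * (w x)%:E) = \int[nu]_u F u.
Proof.
move=> cnu F0 mF; rewrite -wint//.
by apply: eq_measure_integral => // B mB _; exact: cnu.
Qed.

End weighted_integral.

(** * Independence *)

Section independence.
Local Open Scope ereal_scope.
Context d1 d2 (T : measurableType d1) (U : measurableType d2) (R : realType).
Variables (P : probability T R) (I : finType) (Z : I -> T -> U).
Hypothesis mZ : forall i, measurable_fun setT (Z i).
Hypothesis indep : mutually_independent P Z.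

Let measurable_cyl (K : {set I}) (B : I -> set U) :
  (forall i, measurable (B i)) ->
  measurable (\bigcap_(i in [set` K]) Z i @^-1` B i).
Proof.
move=> mB; apply: fin_bigcap_measurable => [|i _]; first exact: finite_finset.
by rewrite -[X in measurable X]setTI; exact: mZ.
Qed.

Lemma integral_prod_independent_le (H : U -> R) (c : R) :
  (0 <= c)%R -> (forall u, (0 <= H u)%R) -> measurable_fun setT H ->
  (forall i, \int[P]_x (H (Z i x))%:E <= c%:E) ->
  \int[P]_x (\prod_i H (Z i x))%:E <= (c ^+ #|I|)%:E.
Proof.
move=> c0 H0 mH Hc.
have mHZ i : measurable_fun setT (fun x => H (Z i x)) by exact: measurableT_comp.
have mprod s : measurable_fun setT (fun x => \prod_(i <- s) H (Z i x))%R.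
  by apply: measurable_prod.
have prod0 s x : (0 <= \prod_(i <- s) H (Z i x))%R by exact: prodr_ge0.
have fP A : measurable A -> P A = (fine (P A))%:E.
  by move=> mA; rewrite fineK// fin_num_measure.
(* Going from indicators to [H] one coordinate at a time. *)
have key (s : seq I) : uniq s -> forall (K : {set I}) (B : I -> set U),
    {in s, forall i, i \notin K} -> (forall i, measurable (B i)) ->
    \int[P]_(x in \bigcap_(i in [set` K]) Z i @^-1` B i)
       (\prod_(i <- s) H (Z i x))%:E
    <= (c ^+ size s * \prod_(i in K) fine (P (Z i @^-1` B i)))%:E.
  elim: s => [_ K B _ mB|j s IH /= /andP[js us] K B sK mB].
    under eq_integral do rewrite big_nil.
    rewrite integral_cst ?mul1e ?expr0 ?mul1r; last exact: measurable_cyl.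
    rewrite [X in X <= _](indep K mB) -prodEFin le_eqVlt; apply/orP; left; apply/eqP.
    apply: eq_bigr => i _; apply: fP.
    by rewrite -[X in measurable X]setTI; exact: mZ.
  set D := \bigcap_(i in _) _.
  have mD : measurable D by exact: measurable_cyl.
  (* The weight [w] collects all factors except the one at [j]: the remaining product and the
     cylinder event. Integrating [H (Z j)] against it is then a case of [weighted_integral_le]. *)
  pose w x := (\prod_(i <- s) H (Z i x) * \1_D x)%R.
  have w0 x : (0 <= w x)%R by rewrite mulr_ge0.
  have mw : measurable_fun setT w by exact: measurable_funM.
  rewrite (_ : \int[P]_(x in D) _ =
      \int[P]_x ((H (Z j x))%:E * (w x)%:E)); last first.
    rewrite integral_mkcond; apply: eq_integral => x _.
    by rewrite epatch_indic/= big_cons -!EFinM mulrA.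
  pose r := (c ^+ size s * \prod_(i in K) fine (P (Z i @^-1` B i)))%R.
  have r0 : (0 <= r)%R.
    by rewrite mulr_ge0 ?exprn_ge0 ?prodr_ge0// => i _; rewrite fine_ge0.
  apply: (@le_trans _ _ (r%:E * \int[pushforward P (Z j)]_u (H u)%:E)).
    apply: (@weighted_integral_le _ _ _ _ _ P (pushforward P (Z j)) w (Z j)
      w0 mw (mZ j) r (EFin \o H)) => //.
    - move=> A mA.
      (* [B'] puts the event [A] at coordinate [j], so the induction hypothesis for [j |: K] is the
         domination of the weighted image measure by [r] times the law of [Z j]. *)
      pose B' i := if i == j then A else B i.
      have mB' i : measurable (B' i) by rewrite /B'; case: ifP.
      have jK : j \notin K by apply: sK; rewrite inE eqxx.
      have BBj : B' j = A by rewrite /B' eqxx.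
      have BB' i : i \in K -> B' i = B i.
        by rewrite /B'; case: eqP => // ->; rewrite (negbTE jK).
      have := IH us (j |: K)%SET B'.
      rewrite big_setU1//= BBj.
      under eq_bigr => i iK do rewrite BB'//.
      move=> /(_ _ mB'); rewrite (_ : \bigcap_(i in _) _ = Z j @^-1` A `&` D).
        rewrite /w integral_mkcondr => le1.
        rewrite (_ : \int[P]_(x in _) _ = \int[P]_(x in Z j @^-1` A)
            (((fun x => (\prod_(i <- s) H (Z i x))%:E) \_ D) x)).
          rewrite /pushforward fP; last first.
            by rewrite -[X in measurable X]setTI; exact: mZ.
          rewrite -EFinM /r mulrAC -mulrA; apply: le1 => i ls.
          rewrite !inE negb_or sK ?inE ?ls ?orbT// andbT.
          by apply: contraNneq js => <-.
        by apply: eq_integral => x _; rewrite epatch_indic.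
      apply/seteqP; split=> [x xD|x [xA xD] i/=].
        split; first by rewrite -BBj; apply: xD => /=; rewrite !inE eqxx.
        by move=> i /= iK; rewrite -BB'//; apply: xD => /=; rewrite !inE iK orbT.
      rewrite !inE => /orP[/eqP->|iK]; first by rewrite BBj.
      by rewrite BB'//; exact: xD.
    - exact/measurable_EFinP.
  rewrite ge0_integral_pushforward//; last 2 first.
  - exact/measurable_EFinP.
  - by move=> u _; rewrite lee_fin.
  rewrite exprS -mulrA [X in _ <= X]EFinM muleC.
  by apply: lee_wpmul2r; rewrite ?lee_fin//; exact: Hc.
(* With [K] empty the cylinder is the whole space and the product of probabilities is 1. *)
have le1 := key _ (index_enum_uniq I) finset.set0 (fun=> setT).
rewrite (_ : #|I| = size (index_enum I)); last by rewrite cardT enumT.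
have := le1 (fun i _ => negbT (finset.in_set0 i)) (fun=> measurableT).
rewrite big_pred0 ?mulr1; last by move=> i; rewrite inE.
by rewrite (_ : \bigcap_(i in _) _ = setT)//; apply/seteqP; split.
Qed.

End independence.

(** * Elementary inequalities *)

(** For [x <= 0], invert [1 - x <= expR (- x)] and use [(1 + x + x^2) (1 - x) = 1 - x^3 >= 1]. For
    [0 < x <= 3/2], the bound [(n+2)! >= 2 * 3^n] makes the term of degree [n + 2] at most
    [x^2 / 2^(n+1)], and these sum to [x^2]. *)
Lemma expR_le1Dxx2 (R : realType) (x : R) :
  x <= 3 / 2 -> expR x <= 1 + x + x ^+ 2.
Proof.
move=> x32; have [x0|x0] := leP x 0.
  have : 1 - x <= expR (- x) by exact: expR_ge1Dx.
  rewrite expRN -[_ <= _^-1]lef_pV2 ?posrE ?invr_gt0 ?expR_gt0//; last lra.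
  rewrite invrK => /le_trans; apply.
  rewrite -[_^-1]mulr1 ler_pdivrMl; last lra.
  nra.
have bound n : series (exp_coeff x) n.+2 <= 1 + x + x ^+ 2 * (1 - 2^-1 ^+ n).
  elim: n => [|n IH].
    rewrite expr0 subrr mulr0 addr0 /series/= !big_nat_recr//= big_nil /exp_coeff/=.
    by rewrite add0r expr0 expr1 fact0 factS fact0 !divr1.
  rewrite /series/= big_nat_recr//=.
  have -> : 1 + x + x ^+ 2 * (1 - 2^-1 ^+ n.+1) =
     1 + x + x ^+ 2 * (1 - 2^-1 ^+ n) + x ^+ 2 * 2^-1 ^+ n.+1 :> R.
    by rewrite (exprS _ n); move: (2^-1 ^+ n) => q; field.
  apply: lerD => //; rewrite /exp_coeff/= -[n.+2]addn2 addnC exprD -mulrA.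
  rewrite ler_wpM2l ?sqr_ge0// ler_pdivrMr ?ltr0n ?fact_gt0//.
  have : x ^+ n <= (3 / 2) ^+ n by rewrite lerXn2r ?nnegrE; lra.
  move=> /le_trans; apply.
  have fact_ge k : (2 * 3 ^ k <= (2 + k)`!)%N.
    elim: k => // k IHk; rewrite addnS factS expnS mulnCA leq_mul//.
  have : 2 * 3 ^+ n <= ((2 + n)`!)%:R :> R by rewrite -natrX -natrM ler_nat.
  rewrite exprMn exprS; set h := 2^-1 ^+ n => h3.
  have h0 : 0 <= h by rewrite exprn_ge0// invr_ge0.
  suff : h * (2 * 3 ^+ n) <= h * (2 + n)`!%:R by lra.
  by rewrite ler_wpM2l.
apply: limr_le; first exact: is_cvg_series_exp_coeff.
near=> n.
have -> : n = (n - 2).+2 by rewrite -addn2 subnK//; near: n; exact: nbhs_infty_ge.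
apply: le_trans (bound _) _.
have h0 : (0 : R) <= 2^-1 ^+ (n - 2) by rewrite exprn_ge0// invr_ge0.
rewrite lerD2l ler_piMr ?sqr_ge0//; lra.
Unshelve. all: by end_near. Qed.


(** Bound [expR] at [b] and [- b] from below by its tangent at [u * b]. The weights [(1 + u) / 2]
    and [(1 - u) / 2] have barycentre [u * b], so the first-order terms cancel. *)
Lemma expRM_convex (R : realType) (u b : R) : `|u| <= 1 ->
  expR (u * b) <= (1 + u) / 2 * expR b + (1 - u) / 2 * expR (- b).
Proof.
rewrite ler_norml => /andP[u1 u2].
have tangent y : expR (u * b) * (1 + (y - u * b)) <= expR y.
  rewrite -[X in _ <= expR X](subrK (u * b)) expRD mulrC.
  by rewrite ler_wpM2r ?expR_ge0 ?expR_ge1Dx.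
have := tangent b; have := tangent (- b).
set e := expR (u * b); set p := expR b; set q := expR (- b) => h1 h2.
have : (1 + u) / 2 * (e * (1 + (b - u * b))) <= (1 + u) / 2 * p.
  by rewrite ler_wpM2l//; lra.
have : (1 - u) / 2 * (e * (1 + (- b - u * b))) <= (1 - u) / 2 * q.
  by rewrite ler_wpM2l//; lra.
have -> : e = (1 + u) / 2 * (e * (1 + (b - u * b))) +
   (1 - u) / 2 * (e * (1 + (- b - u * b))) by field.
lra.
Qed.

Lemma measurable_invr (R : realType) : measurable_fun [set: R] (@GRing.inv R).
Proof.
rewrite -(setUv [set 0 : R]); apply/measurable_funU => //; first exact: measurableC.
split; first exact: measurable_fun_set1.
apply: open_continuous_measurable_fun => [|x].
  exact/closed_openC/accessible_closed_set1/hausdorff_accessible/Rhausdorff.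
by rewrite inE => /eqP x0; exact: inv_continuous.
Qed.

(** * Sub-Gaussian noise *)

Section noise.
Local Open Scope ereal_scope.
Context (R : realType) (n : nat) d (T : measurableType d) (P : probability T R).
Variables (X : {RV P >-> n.-tuple R}) (eps : {RV P >-> R}).
Hypothesis subgaussian : C4 X eps.

(** The conditional moment bound controls [expR (t * eps)] on each event [X \in B];
    [weighted_integral_le] with this exponential as weight extends the control from events to
    [F]. *)
Lemma expectation_expR_noise_le (t : R) (F : n.-tuple R -> R) :
  (forall x, (0 <= F x)%R) -> measurable_fun setT F ->
  \int[P]_w (F (X w) * expR (t * eps w))%:E <=
  (expR (t ^+ 2 / 2))%:E * \int[P]_w (F (X w))%:E.
Proof.
move=> F0 mF; have mX : measurable_fun setT X by [].
have -> : \int[P]_w (F (X w))%:E = \int[pushforward P X]_x (F x)%:E.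
  rewrite ge0_integral_pushforward//; last by move=> x _; rewrite lee_fin.
  exact/measurable_EFinP.
have mexp : measurable_fun setT (fun w => expR (t * eps w)).
  by apply: measurableT_comp => //; exact: measurable_funM.
under eq_integral do rewrite EFinM.
have exp0 w : (0 <= expR (t * eps w))%R by exact: expR_ge0.
apply: (@weighted_integral_le _ _ _ _ _ P (pushforward P X) _ X exp0 mexp mX
  _ (EFin \o F)) => //.
- move=> B mB; case: subgaussian => h /(_ t)[_ mh ih ->//] hexp.
  have mXB : measurable (X @^-1` B) by rewrite -[X in measurable X]setTI; exact: mX.
  have mhX : measurable_fun (X @^-1` B) (fun w => (h t (X w))%:E).
    by apply/measurable_EFinP/measurable_funTS; exact: measurableT_comp.
  (* The version [h t] is not known to be nonnegative; its positive part is, and it obeys the same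
     almost sure upper bound. *)
  apply: (@le_trans _ _ (\int[P]_(w in X @^-1` B) ((fun w => (h t (X w))%:E)^\+ w))).
    rewrite integralE geeDl// leeNl oppe0; exact: integral_ge0.
  apply: (@le_trans _ _ (\int[P]_(w in X @^-1` B) (cst (expR (t ^+ 2 / 2))%:E w))).
    apply: ae_ge0_le_integral => //.
    + exact: measurable_funepos.
    + by move=> w _; rewrite lee_fin expR_ge0.
    + apply: filterS hexp => w hw _; rewrite funeposE ge_max.
      by rewrite !lee_fin hw expR_ge0.
  by rewrite integral_cst.
- exact/measurable_EFinP.
Qed.

(* [u x * (a * e)] is a convex combination of [a * e] and [- (a * e)], which
   reduces the random multiplier [a * u (X w)] to the constants [a] and [- a]. *)
Lemma expectation_expR_bounded_noise_le (a : R) (u F : n.-tuple R -> R) :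
  (forall x, (`|u x| <= 1)%R) -> measurable_fun setT u ->
  (forall x, (0 <= F x)%R) -> measurable_fun setT F ->
  \int[P]_w (F (X w) * expR (u (X w) * (a * eps w)))%:E <=
  (expR (a ^+ 2 / 2))%:E * \int[P]_w (F (X w))%:E.
Proof.
move=> u1 mu F0 mF.
have mX : measurable_fun setT X by [].
(* For [s = 1] and [s = -1] these are two nonnegative weights with sum [F]; each is paired with the
   constant multiplier [s * a] of the noise. *)
pose Fp (s : R) x := (F x * ((1 + s * u x) / 2))%R.
have Fp0 (s : R) x : (`|s| = 1)%R -> (0 <= Fp s x)%R.
  move=> s1; rewrite mulr_ge0// divr_ge0// -lerBlDl sub0r.
  by have := u1 x; rewrite -(mul1r `|_|%R) -s1 -normrM ler_norml => /andP[].
have mFp s : measurable_fun setT (Fp s).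
  apply: measurable_funM => //; apply: measurable_funM => //.
  by apply: measurable_funD => //; exact: measurable_funM.
have mFpX s : measurable_fun setT (fun w => (Fp s (X w))%:E).
  by apply/measurable_EFinP; exact: measurableT_comp.
have mFe s b : measurable_fun setT (fun w => (Fp s (X w) * expR (b * eps w))%:E).
  apply/measurable_EFinP; apply: measurable_funM; first exact: measurableT_comp.
  by apply: measurableT_comp => //; exact: measurable_funM.
have le (s : R) : (`|s| = 1)%R -> \int[P]_w (Fp s (X w) * expR ((s * a) * eps w))%:E <=
    (expR (a ^+ 2 / 2))%:E * \int[P]_w (Fp s (X w))%:E.
  move=> s1; rewrite (_ : (a ^+ 2 = (s * a) ^+ 2)%R).
    by apply: expectation_expR_noise_le => // x; exact: Fp0.
  by rewrite exprMn -(real_normK (num_real s)) s1 expr1n mul1r.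
have n1 : (`|1 : R| = 1)%R by rewrite normr1.
have nN1 : (`|-1 : R| = 1)%R by rewrite normrN1.
have -> : \int[P]_w (F (X w))%:E =
    \int[P]_w (Fp 1%R (X w))%:E + \int[P]_w (Fp (-1)%R (X w))%:E.
  rewrite -ge0_integralD//; [|by move=> w _; rewrite lee_fin Fp0..].
  by apply: eq_integral => w _; rewrite -EFinD /Fp; congr EFin; field.
rewrite ge0_muleDr; [|by apply: integral_ge0 => w _; rewrite lee_fin Fp0..].
apply: le_trans (leeD (le _ n1) (le _ nN1)).
rewrite -ge0_integralD//; [|by move=> w _; rewrite lee_fin mulr_ge0 ?Fp0 ?expR_ge0..].
apply: ge0_le_integral => //.
- by move=> w _; rewrite lee_fin mulr_ge0 ?expR_ge0.
- apply/measurable_EFinP; apply: measurable_funM; first exact: measurableT_comp.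
  apply: measurableT_comp => //; apply: measurable_funM; first exact: measurableT_comp.
  exact: measurable_funM.
- by apply: emeasurable_funD.
- move=> w _; rewrite -EFinD lee_fin /Fp !mul1r !mulN1r.
  rewrite -!mulrA -mulrDr ler_wpM2l// !mulrA mulNr.
  by rewrite -mulrA; exact: expRM_convex.
Qed.

End noise.

(** * The Fourier basis and the noiseless signal *)

Section fourier_basis.
Context (R : realType) (d : nat).
Implicit Types (k : d.-tuple int) (x : d.-tuple R).

Lemma phi_le k x : `|phi k x| <= Num.sqrt 2.
Proof.
have sqrt2 : 1 <= Num.sqrt 2 :> R by rewrite -[leLHS]sqrtr1 ler_sqrt// ler1n.
rewrite /phi; case: ifP => _; first by rewrite normr1.
case: ifP => _; rewrite normrM ger0_norm ?sqrtr_ge0// ler_piMr ?sqrtr_ge0//.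
- by rewrite ler_norml cos_geN1 cos_le1.
- by rewrite ler_norml sin_geN1 sin_le1.
Qed.

Lemma measurable_dotz k : measurable_fun setT (@dotz R d k).
Proof.
apply: measurable_sum => i; apply: measurable_funM => //.
exact: measurable_tnth.
Qed.

Lemma measurable_phi k : measurable_fun setT (@phi R d k).
Proof.
rewrite /phi; case: [forall i, _] => //.
have m2 : measurable_fun setT (fun x => 2 * pi * dotz k x).
  by apply: measurable_funM => //; exact: measurable_dotz.
case: zpos; apply: measurable_funM => //.
- apply: measurableT_comp => //.
  by apply: continuous_measurable_fun => y; exact: continuous_cos.
- apply: measurableT_comp => //.
  by apply: continuous_measurable_fun => y; exact: continuous_sin.
Qed.

Lemma measurable_unit_cube : measurable (unit_cube R d).
Proof.
rewrite (_ : unit_cube R d = \bigcap_(i in [set: 'I_d])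
  ((fun x => tnth x i) @^-1` `[0, 1])).
  apply: fin_bigcap_measurable => [|i _]; first exact: finite_finset.
  by rewrite -[X in measurable X]setTI; apply: measurable_tnth.
by apply/seteqP; split=> x /= h i => [_|]; have := h i; rewrite /= in_itv/=; apply.
Qed.

End fourier_basis.

(** * Moments of the noiseless summand *)

Section signal.
Local Open Scope ereal_scope.
Context (R : realType) (d : nat) disp (T : measurableType disp).
Context (P : probability T R) (X : {RV P >-> d.-tuple R}).
Variables (f g : d.-tuple R -> R) (gmin Linf L2 : R) (k : d.-tuple int).
Hypotheses (gmin_gt0 : (0 < gmin)%R) (f_meas : measurable_fun setT f).
Hypotheses (density : has_density X g) (HC1 : C1 gmin g) (HC3 : C3 X Linf L2 f g).

Local Notation lambda_d := (lebesgue_tuple R d).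
Local Notation cube := (unit_cube R d).

Let g_meas : measurable_fun setT g. Proof. by case: density. Qed.
Let g_ge0 x : (0 <= g x)%R. Proof. by case: density. Qed.

Let mX : measurable_fun setT X. Proof. by []. Qed.

Lemma integral_density (F : d.-tuple R -> R) :
  (forall x, (0 <= F x)%R) -> measurable_fun setT F ->
  \int[distribution P X]_x (F x)%:E = \int[lambda_d]_x (F x * g x)%:E.
Proof.
move=> F0 mF; under [RHS]eq_integral do rewrite EFinM.
apply/esym; apply: (@weighted_integral_eq _ _ _ _ _ lambda_d _ g idfun) => //.
- exact: measurable_id.
- move=> B mB; case: density => _ _ /(_ _ mB) gB.
  by rewrite preimage_id; exact/esym/gB.
- exact/measurable_EFinP.
Qed.

(* Vanishes outside the cube, where [g x = 0] and [0^-1 = 0]. *)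
Definition phi_over_g x := (phi k x / g x)%R.

Lemma measurable_phi_over_g : measurable_fun setT phi_over_g.
Proof.
apply: measurable_funM; first exact: measurable_phi.
by apply: measurableT_comp => //; exact: measurable_invr.
Qed.

Lemma phi_over_g_le x : (`|phi_over_g x| <= Num.sqrt 2 / gmin)%R.
Proof.
rewrite /phi_over_g normrM ler_pM ?phi_le//.
have [xc|xc] := pselect (cube x).
  have gx := HC1.2 _ xc.
  by rewrite ger0_norm ?invr_ge0// lef_pV2 ?posrE//; exact: lt_le_trans gx.
by rewrite HC1.1// invr0 normr0 invr_ge0 ltW.
Qed.

Definition signal x := (phi_over_g x * f x)%R.

Let Z := signal.
Let nu := distribution P X.

Let mZ : measurable_fun setT Z.
Proof. by apply: measurable_funM => //; exact: measurable_phi_over_g. Qed.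

(** The factor [1 / g] cancels the density on the cube, and [g] vanishes off it. This is the source
    of the unbiasedness of the empirical coefficient. *)
Let Zg x : (Z x * g x = ((fun x => f x * phi k x) \_ cube) x)%R.
Proof.
rewrite patchE; case: ifPn => [|] xc.
  have gx := HC1.2 _ (set_mem xc).
  rewrite /Z /signal /phi_over_g; field.
  by rewrite gt_eqF//; exact: lt_le_trans gx.
by rewrite HC1.1 ?mulr0// => xc'; rewrite mem_set in xc.
Qed.

(** The multiplier [phi_over_g] is at most [sqrt 2 / gmin] in absolute value, which leaves the
    weighted second moment of [f] bounded in [C3]. *)
Lemma integral_signal_sqr : \int[nu]_x (Z x ^+ 2)%:E <= (2 * L2 ^+ 2 / gmin ^+ 2)%:E.
Proof.
rewrite integral_density; [|by move=> x; exact: sqr_ge0|exact: measurable_funX].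
have [_ le2] := HC3.
rewrite mulrAC EFinM; apply: le_trans; last first.
  by apply: lee_wpmul2l le2; rewrite lee_fin divr_ge0// sqr_ge0.
rewrite [X in _ * X]integral_mkcond -ge0_integralZl//; last 3 first.
- apply/(measurable_restrictT _ _).1; first exact: measurable_unit_cube.
  apply/measurable_EFinP/measurable_funTS; apply: measurable_funM => //.
  exact: measurable_funX.
- by move=> x _; apply: erestrict_ge0 => y _; rewrite lee_fin mulr_ge0 ?sqr_ge0.
- by rewrite lee_fin divr_ge0// sqr_ge0.
apply: ge0_le_integral => //.
- by move=> x _; rewrite lee_fin mulr_ge0 ?sqr_ge0.
- by apply/measurable_EFinP/measurable_funM => //; exact: measurable_funX.
- apply: emeasurable_funM => //.
  apply/(measurable_restrictT _ _).1; first exact: measurable_unit_cube.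
  apply/measurable_EFinP/measurable_funTS; apply: measurable_funM => //.
  exact: measurable_funX.
- move=> x _; rewrite patchE; case: ifPn => xc; last first.
    by rewrite HC1.1 ?mulr0 ?mule0// => xc'; rewrite mem_set in xc.
  rewrite -EFinM lee_fin /Z /signal exprMn -mulrA ler_wpM2r ?(mulr_ge0 (sqr_ge0 _))//.
  rewrite -(real_normK (num_real (phi_over_g x))).
  rewrite -(sqr_sqrtr (ler0n R 2)) -expr_div_n lerXn2r ?nnegrE//.
  + by rewrite divr_ge0 ?sqrtr_ge0// ltW.
  + exact: phi_over_g_le.
Qed.

Let integrable_sqr : nu.-integrable setT (fun x => (Z x ^+ 2)%:E).
Proof.
apply/integrableP; split.
  by apply/measurable_EFinP; exact: measurable_funX.
under eq_integral do rewrite gee0_abs ?lee_fin ?sqr_ge0//.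
exact: le_lt_trans integral_signal_sqr (ltry _).
Qed.

Let integrable_cst (c : R) : nu.-integrable setT (cst c%:E).
Proof. exact: finite_measure_integrable_cst. Qed.

Let integrable_signal : nu.-integrable setT (fun x => (Z x)%:E).
Proof.
apply: (@le_integrable _ _ _ nu _ _ _ (fun x => 1%:E + (Z x ^+ 2)%:E)) => //.
- exact/measurable_EFinP.
- move=> x _; rewrite -EFinD !abse_EFin lee_fin [leRHS]ger0_norm; last first.
    by rewrite addr_ge0// sqr_ge0.
  rewrite -(real_normK (num_real (Z x))); have := normr_ge0 (Z x); nra.
- apply: integrableD => //; exact: integrable_cst.
Qed.

(** Positive and negative parts are treated separately, since [integral_density] concerns
    nonnegative functions; [Zg] then identifies each part. *)
Lemma integral_signal : \int[nu]_x (Z x)%:E = (theta f k)%:E.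
Proof.
rewrite /theta /Rintegral -[LHS]fineK; last exact: integrable_fin_num.
congr (fine _)%:E.
rewrite [RHS]integral_mkcond [LHS]integralE [RHS]integralE.
have Zp : measurable_fun setT (fun x => Num.max (Z x) 0)%R.
  exact: measurable_maxr.
have Zn : measurable_fun setT (fun x => Num.max (- Z x) 0)%R.
  by apply: measurable_maxr => //; exact: measurable_funN.
congr (_ - _).
- under eq_integral => x _ do rewrite funeposE -EFin_max.
  rewrite integral_density//; last by move=> x; rewrite le_max lexx orbT.
  apply: eq_integral => x _; rewrite funeposE maxr_pMl// mul0r EFin_max Zg.
  by congr maxe; rewrite !patchE; case: ifP.
- under eq_integral => x _ do rewrite funenegE -EFinN -EFin_max.
  rewrite integral_density//; last by move=> x; rewrite le_max lexx orbT.
  apply: eq_integral => x _; rewrite funenegE maxr_pMl// mul0r mulNr EFin_max Zg.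
  by congr maxe; rewrite !patchE; case: ifP.
Qed.

(** Almost surely [|f| <= Linf], so the exponent stays below 3/2 and [expR_le1Dxx2] applies. The
    linear term integrates to [s * theta f k], the quadratic one is bounded by
    [integral_signal_sqr], and [1 + y <= expR y] restores an exponential. *)
Lemma expectation_expR_signal_le (s : R) :
  (`|s| * (Num.sqrt 2 * Linf / gmin) <= 3 / 2)%R ->
  \int[P]_w (expR (s * Z (X w)))%:E <=
  (expR (s * theta f k + s ^+ 2 * (2 * L2 ^+ 2 / gmin ^+ 2)))%:E.
Proof.
move=> sb.
have mE : measurable_fun setT (fun x => expR (s * Z x)).
  by apply: measurableT_comp => //; exact: measurable_funM.
have -> : \int[P]_w (expR (s * Z (X w)))%:E = \int[nu]_x (expR (s * Z x))%:E.
  by rewrite ge0_integral_pushforward//; exact/measurable_EFinP.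
have bae : {ae nu, forall x, cube x /\ (`|f x| <= Linf)%R}.
  pose A := [set x | cube x /\ (`|f x| <= Linf)%R].
  have mA : measurable A.
    rewrite (_ : A = cube `&` (fun x => `|f x|)%R @^-1` `]-oo, Linf]).
      apply: measurableI; first exact: measurable_unit_cube.
      rewrite -[X in measurable X]setTI.
      have mabs : measurable_fun setT (fun x => `|f x|)%R.
        by apply: measurableT_comp.
      by apply: mabs.
    by apply/seteqP; split=> x /=; rewrite in_itv.
  exists (~` A); split; first exact: measurableC.
    rewrite [LHS](probability_setC (distribution P X))//.
    by rewrite [X in _ - X]HC3.1 subee.
  by move=> x.
apply: (@le_trans _ _ (\int[nu]_x (1 + (s * Z x) + (s * Z x) ^+ 2)%:E)).
  apply: ae_ge0_le_integral => //.
  - exact/measurable_EFinP.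
  - by move=> x _; rewrite lee_fin; nra.
  - apply/measurable_EFinP; apply: measurable_funD.
      by apply: measurable_funD => //; exact: measurable_funM.
    by apply: measurable_funX; exact: measurable_funM.
  - apply: filterS bae => x [xc fx] _; rewrite lee_fin; apply: expR_le1Dxx2.
    apply: le_trans sb; apply: le_trans (ler_norm _) _.
    rewrite normrM ler_wpM2l// /Z /signal normrM mulrAC ler_pM//.
    exact: phi_over_g_le.
under eq_integral do rewrite EFinD EFinD exprMn (EFinM s) (EFinM (s ^+ 2)%R).
have i1 : nu.-integrable setT (fun x => s%:E * (Z x)%:E) by exact: integrableZl.
have i2 : nu.-integrable setT (fun x => (s ^+ 2)%:E * (Z x ^+ 2)%:E).
  exact: integrableZl.
have i0 : nu.-integrable setT (cst (1%:E : \bar R)) by exact: integrable_cst.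
rewrite integralD//; last exact: integrableD.
rewrite integralD// integral_cst// [X in _ * X](probability_setT nu) mule1.
rewrite [X in _ + X]integralZl// integralZl// integral_signal.
apply: (@le_trans _ _ (1 + s * theta f k + s ^+ 2 * (2 * L2 ^+ 2 / gmin ^+ 2))%:E).
  rewrite EFinD leeD// (EFinM (s ^+ 2)%R).
  by rewrite lee_wpmul2l ?lee_fin ?sqr_ge0// integral_signal_sqr.
by rewrite lee_fin -addrA expR_ge1Dx.
Qed.

End signal.

(** * Concentration of the empirical coefficients *)

Section concentration.
Local Open Scope ereal_scope.
Context (R : realType) (d n : nat) disp (T : measurableType disp).
Context (P : probability T R) (X : 'I_n -> {RV P >-> d.-tuple R}).
Context (Y eps : 'I_n -> {RV P >-> R}).
Variables (f g : d.-tuple R -> R) (sigma gmin Linf L2 : R).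
Hypotheses (n_gt0 : (0 < n)%N) (gmin_gt0 : (0 < gmin)%R).
Hypothesis f_meas : measurable_fun setT f.
Hypothesis indep : mutually_independent P (fun i w => (X i w, Y i w)).
Hypothesis model : forall i w, Y i w = (f (X i w) + sigma * eps i w)%R.
Hypotheses (density : forall i, has_density (X i) g) (HC1 : C1 gmin g).
Hypotheses (HC3 : forall i, C3 (X i) Linf L2 f g).
Hypothesis HC4 : forall i, C4 (X i) (eps i).
Variable k : d.-tuple int.

Local Notation psi := (phi_over_g g k).
Local Notation V := ((sigma ^+ 2 + 2 * L2 ^+ 2) / gmin ^+ 2)%R.

Let mpsi : measurable_fun setT psi.
Proof. exact: (measurable_phi_over_g k (density (Ordinal n_gt0))). Qed.

Let psi_le x : (`|psi x| <= Num.sqrt 2 / gmin)%R.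
Proof. exact: (phi_over_g_le k gmin_gt0 (density (Ordinal n_gt0)) HC1). Qed.

Lemma expectation_expR_observation_le (i : 'I_n) (s : R) :
  (`|s| * (Num.sqrt 2 * Linf / gmin) <= 3 / 2)%R ->
  \int[P]_w (expR (s * (psi (X i w) * Y i w)))%:E <=
  (expR (s * theta f k + s ^+ 2 * V))%:E.
Proof.
move=> sb; have s20 : (0 < Num.sqrt 2 :> R)%R by rewrite sqrtr_gt0.
(* [u] is [psi] normalised to absolute value at most 1. The compensating factor enters [a], and
   [a^2 / 2 = s^2 sigma^2 / gmin^2] is the noise share of [s^2 * V]. *)
pose u x := (psi x * (gmin / Num.sqrt 2))%R.
pose a := (s * sigma * (Num.sqrt 2 / gmin))%R.
pose F x := expR (s * signal f g k x).
have -> : \int[P]_w (expR (s * (psi (X i w) * Y i w)))%:E =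
    \int[P]_w (F (X i w) * expR (u (X i w) * (a * eps i w)))%:E.
  apply: eq_integral => w _; rewrite /F /signal -expRD model /u /a.
  congr (expR _)%:E; field; rewrite !gt_eqF//.
apply: le_trans (expectation_expR_bounded_noise_le (HC4 i) a _ _ _ _) _.
- move=> x; rewrite /u normrM [X in (_ * X)%R]gtr0_norm ?divr_gt0//.
  by rewrite -ler_pdivlMr ?divr_gt0// mul1r invf_div.
- by apply: measurable_funM.
- by move=> x; exact: expR_ge0.
- apply: measurableT_comp => //; apply: measurable_funM => //.
  exact: measurable_funM.
apply: (le_trans (lee_wpmul2l _ (expectation_expR_signal_le k gmin_gt0 f_meas
  (density i) HC1 (HC3 i) sb))); first by rewrite lee_fin expR_ge0.
rewrite -EFinM lee_fin -expRD ler_expR /a.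
rewrite le_eqVlt; apply/orP; left; apply/eqP.
rewrite !exprMn exprVn sqr_sqrtr//; field.
by rewrite gt_eqF.
Qed.

Let obs (w : T) := (\sum_(i < n) psi (X i w) * Y i w)%R.

Let mobs : measurable_fun setT obs.
Proof.
apply: measurable_sum => i; apply: measurable_funM => //.
by apply: measurableT_comp.
Qed.

Let mge (h : T -> R) (b : R) : measurable_fun setT h ->
  measurable [set w | (b <= h w)%R].
Proof.
move=> mh; rewrite (_ : [set _ | _] = h @^-1` `[b, +oo[).
  by rewrite -[X in measurable X]setTI; exact: mh.
by apply/seteqP; split=> w /=; rewrite in_itv/= andbT.
Qed.

Lemma observation_sum_tail (s b : R) :
  (`|s| * (Num.sqrt 2 * Linf / gmin) <= 3 / 2)%R ->
  P [set w | (b <= s * obs w)%R] <=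
  (expR (n%:R * (s * theta f k + s ^+ 2 * V) - b))%:E.
Proof.
move=> sb.
have mso : measurable_fun setT (fun w => s * obs w)%R by exact: measurable_funM.
(* Markov's inequality: the indicator of the event is at most [expR (s * obs w - b)]. Independence
   then factors the exponential of the sum. *)
apply: (@le_trans _ _ (\int[P]_w (expR (- b) * expR (s * obs w))%:E)).
  rewrite -[leLHS]mul1e -integral_cst; last exact: mge.
  rewrite integral_mkcond; apply: ge0_le_integral => //.
  - by move=> w _; apply: erestrict_ge0.
  - by apply/(measurable_restrictT _ _).1 => //; exact: mge.
  - apply/measurable_EFinP; apply: measurable_funM => //.
    exact: measurableT_comp.
  - move=> w _; rewrite patchE; case: ifPn => wb; rewrite lee_fin.
    + rewrite -expRD -expR0 ler_expR addrC subr_ge0.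
      by move: wb; rewrite inE.
    + by rewrite mulr_ge0 ?expR_ge0.
under eq_integral do rewrite EFinM.
rewrite ge0_integralZl//; last first.
  by apply/measurable_EFinP; exact: measurableT_comp.
rewrite [leRHS](_ : _ = (expR (- b))%:E *
    (expR (s * theta f k + s ^+ 2 * V) ^+ n)%:E); last first.
  by rewrite -EFinM -expRM_natl -expRD; congr (expR _)%:E; rewrite addrC -mulr_natl.
apply: lee_wpmul2l; first by rewrite lee_fin expR_ge0.
pose H (z : d.-tuple R * R) := expR (s * (psi z.1 * z.2)).
rewrite (_ : \int[P]_w _ = \int[P]_w (\prod_(i < n) H (X i w, Y i w))%:E); last first.
  by apply: eq_integral => w _; rewrite /H/= -expR_sum -mulr_sumr.
have := integral_prod_independent_le _ indep
  (c := expR (s * theta f k + s ^+ 2 * V)) (H := H).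
rewrite card_ord; apply.
- by move=> i; apply/measurable_fun_pairP; split.
- exact: expR_ge0.
- by move=> z; exact: expR_ge0.
- apply: measurableT_comp => //; apply: measurable_funM => //.
  apply: measurable_funM => //.
  by apply: measurableT_comp.
- by move=> i; exact: expectation_expR_observation_le.
Qed.

Lemma measurable_theta_hat :
  measurable_fun setT (fun w => theta_hat g (X^~ w) (Y^~ w) k).
Proof. by apply: measurable_funM. Qed.

Lemma theta_hat_tail (s lambda : R) : (0 < s)%R ->
  (s * (Num.sqrt 2 * Linf / gmin) <= 3 / 2)%R ->
  P [set w | (lambda <= `|theta_hat g (X^~ w) (Y^~ w) k - theta f k|)%R] <=
  (2 * expR (n%:R * (s ^+ 2 * V - s * lambda)))%:E.
Proof.
move=> s0 sb; have n0 : (0 < n%:R :> R)%R by rewrite ltr0n.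
have msobs (c : R) : measurable_fun setT (fun w => c * obs w)%R.
  exact: measurable_funM.
(* The thresholds for the upper tail, used with parameter [s], and for the lower tail, used with
   [- s]. In both exponents the terms in [theta f k] cancel. *)
pose b1 := (s * (n%:R * (lambda + theta f k)))%R.
pose b2 := (s * (n%:R * (lambda - theta f k)))%R.
apply: (@le_trans _ _ (P ([set w | (b1 <= s * obs w)%R] `|`
                          [set w | (b2 <= (- s) * obs w)%R]))).
  apply: le_measure; rewrite ?inE.
  - apply: mge; apply: measurableT_comp => //; apply: measurable_funB => //.
    exact: measurable_theta_hat.
  - by apply: measurableU; exact: mge.
  - move=> w; rewrite /= /theta_hat ler_normr -/(obs w) => /orP[|] h; [left|right].
    + rewrite /b1 ler_pM2l// mulrC -ler_pdivlMr// mulrC; lra.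
    + rewrite /b2 mulNr -mulrN ler_pM2l// mulrC -ler_pdivlMr// mulrC mulrN; lra.
apply: le_trans (measureU2 _ _ _) _; [exact: mge|exact: mge|].
have -> : (2 * expR (n%:R * (s ^+ 2 * V - s * lambda)))%:E =
    (expR (n%:R * (s * theta f k + s ^+ 2 * V) - b1))%:E +
    (expR (n%:R * (- s * theta f k + (- s) ^+ 2 * V) - b2))%:E.
  rewrite -EFinD mulr_natl mulr2n; congr (_ + _)%:E; congr expR; rewrite /b1 /b2; ring.
by apply: leeD; apply: observation_sum_tail; rewrite ?normrN gtr0_norm.
Qed.

End concentration.

(** * Rotations of the unit cube and vanishing coefficients *)

Section translation.
Context (R : realType).
Implicit Types (a c : R) (A : set R).

Lemma lebesgue_measure_translation c A : measurable A ->
  lebesgue_measure ((fun x => x + c) @^-1` A) = lebesgue_measure A.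
Proof.
move=> mA.
pose t (x : R) : measurableTypeR R := x + c.
have mc : measurable_fun [set: measurableTypeR R] t.
  by apply: measurable_funD.
apply/esym.
apply: (@lebesgue_measure_unique R (pushforward (@lebesgue_measure R) t)) => //.
move=> _ [[p q] _ <-] /=; rewrite /pushforward.
rewrite (_ : _ @^-1` _ = `]p - c, q - c]%classic); last first.
  by apply/seteqP; split=> x /=; rewrite !in_itv/= ltrBlDr lerBrDr.
rewrite !lebesgue_measure_itv/= !lte_fin ltrD2r; case: ifP => // _.
by rewrite -!EFinB; congr EFin; lra.
Qed.

(* Translation by [a] modulo 1 on [0, 1), extended by the identity. *)
Definition rotation a (x : R) : R :=
  if (0 <= x) && (x < 1 - a) then x + a
  else if (1 - a <= x) && (x < 1) then x + a - 1 else x.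

Lemma measurable_rotation a : measurable_fun setT (rotation a).
Proof.
apply: measurable_fun_ifT; [|exact: measurable_funD|apply: measurable_fun_ifT].
- by apply: measurable_and; [exact: measurable_fun_ler|exact: measurable_fun_ltr].
- by apply: measurable_and; [exact: measurable_fun_ler|exact: measurable_fun_ltr].
- by apply: measurable_funB => //; exact: measurable_funD.
- by [].
Qed.

Lemma lebesgue_measure_rotation a A : 0 <= a <= 1 -> measurable A ->
  lebesgue_measure (rotation a @^-1` A) = lebesgue_measure A.
Proof.
move=> a01 mA.
have mI (p q : R) : measurable (A `&` `[p, q[) by apply: measurableI.
have mD : measurable (A `\` `[0, 1[) by apply: measurableD.
have mt c (B : set R) : measurable B -> measurable ((fun x => x + c) @^-1` B).
  move=> mB; rewrite -[X in measurable X]setTI.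
  have : measurable_fun setT (fun x : R => x + c) by exact: measurable_funD.
  by apply.
(* Points shifted by [a] land in [[a, 1[], those shifted by [a - 1] land in [[0, a[], and the others
   are fixed. The preimage is thus a disjoint union of translates of three pieces that partition
   [A]. *)
have -> : rotation a @^-1` A =
    ((fun x => x + a) @^-1` (A `&` `[a, 1[)) `|`
    ((fun x => x + (a - 1)) @^-1` (A `&` `[0, a[)) `|` (A `\` `[0, 1[).
  apply/seteqP; split=> x /=; rewrite /rotation !in_itv/=.
    case: ifPn => [h Ax|h1]; first by left; left; split=> //; lra.
    case: ifPn => [h Ax|h2 Ax]; first by left; right; rewrite addrA; split=> //; lra.
    by right; split=> // h; move: h1 h2; rewrite !negb_and -!ltNge -!leNgt; lra.
  move=> [[[Ax h]|[Ax h]]|[Ax h]].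
  - by rewrite ifT//; lra.
  - rewrite ifF; last by apply/negP; lra.
    by rewrite ifT -?addrA//; lra.
  - rewrite ifF; last by apply/negP => ?; apply: h; lra.
    by rewrite ifF//; apply/negP => ?; apply: h; lra.
have mU (B C : set R) : measurable B -> measurable C -> B `&` C = set0 ->
    lebesgue_measure (B `|` C) = (lebesgue_measure B + lebesgue_measure C)%E.
  by move=> mB mC BC; exact: measureU.
rewrite mU//; last 2 first.
- by apply: measurableU; exact: mt.
- by apply/seteqP; split=> x //=; rewrite !in_itv/= => -[[[_ h]|[_ h]] [_ h']];
    apply: h'; lra.
rewrite mU; [|exact: mt|exact: mt|]; last first.
  by apply/seteqP; split=> x //=; rewrite !in_itv/=  => -[[_ h] [_ h']]; lra.
rewrite (lebesgue_measure_translation a (mI _ _)).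
rewrite (lebesgue_measure_translation (a - 1) (mI _ _)).
rewrite -mU; [|exact: mI|exact: mI|]; last first.
  by apply/seteqP; split=> x //=; rewrite !in_itv/=  => -[[_ h] [_ h']]; lra.
rewrite -mU; [|by apply: measurableU; exact: mI|exact: mD|]; last first.
  by apply/seteqP; split=> x //=; rewrite !in_itv/= => -[[[_ h]|[_ h]] [_ h']];
    apply: h'; lra.
have -> : A `&` `[a, 1[ `|` A `&` `[0, a[ `|` A `\` `[0, 1[ = A.
  apply/seteqP; split=> x /=; rewrite !in_itv/=; first by move=> [[[]|[]]|[]].
  move=> Ax; have [h|h] := boolP ((0 <= x) && (x < 1)); last first.
    by right; split=> //; apply/negP.
  by left; have [xa|xa] := ltP x a; [right|left]; split=> //; lra.
by [].
Qed.

Lemma integral_rotation a (F : R -> \bar R) : 0 <= a <= 1 ->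
  (forall x, (0 <= F x)%E) -> measurable_fun setT F ->
  (\int[lebesgue_measure]_x F (rotation a x) = \int[lebesgue_measure]_x F x)%E.
Proof.
move=> a01 F0 mF.
pose r : measurableTypeR R -> measurableTypeR R := rotation a.
have mr : measurable_fun [set: measurableTypeR R] r by exact: measurable_rotation.
transitivity (\int[pushforward (@lebesgue_measure R) r]_x F x)%E.
  rewrite (@ge0_integral_pushforward _ _ (measurableTypeR R)
    (measurableTypeR R) R r mr (@lebesgue_measure R) setT F).
  - by [].
  - exact: measurableT.
  - exact: mF.
  - by [].
apply: eq_measure_integral => A mA _.
exact: lebesgue_measure_rotation.
Qed.

End translation.

(** * Rotating one coordinate of the product space *)

Section coordinate_rotation.
Context (R : realType).

Lemma integral_lebesgue_tupleS d (F : d.+1.-tuple R -> \bar R) :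
  (forall x, (0 <= F x)%E) -> measurable_fun setT F ->
  (\int[lebesgue_tuple R d.+1]_x F x =
   \int[@lebesgue_measure R \x lebesgue_tuple R d]_p F (tcons p))%E.
Proof.
move=> F0 mF; rewrite [LHS](@ge0_integral_pushforward _ _ _ _ _ (@tcons R d)).
- by [].
- exact: measurable_tcons.
- by [].
- exact: mF.
- by move=> x _; exact: F0.
Qed.

Definition coord_rotation d (j : 'I_d) (a : R) (x : d.-tuple R) : d.-tuple R :=
  [tuple if i == j then rotation a (tnth x i) else tnth x i | i < d].

Lemma tnth_coord_rotation d (j : 'I_d) (a : R) (x : d.-tuple R) i :
  tnth (coord_rotation j a x) i =
  if i == j then rotation a (tnth x i) else tnth x i.
Proof. by rewrite tnth_mktuple. Qed.

Lemma measurable_coord_rotation d (j : 'I_d) (a : R) :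
  measurable_fun setT (coord_rotation j a).
Proof.
apply/measurable_fun_tnthP => i.
rewrite (_ : _ \o _ = fun x =>
    if i == j then rotation a (tnth x i) else tnth x i); last first.
  by apply/funext => x /=; rewrite tnth_coord_rotation.
case: eqP => _; last exact: measurable_tnth.
by apply: measurableT_comp; [exact: measurable_rotation|exact: measurable_tnth].
Qed.

Lemma coord_rotation0 d (a : R) (p : measurableTypeR R * d.-tuple R) :
  coord_rotation ord0 a (tcons p) = tcons (rotation a p.1, p.2).
Proof.
apply: eq_from_tnth => i; rewrite tnth_coord_rotation.
by have [i0 ->|->] := unliftP ord0 i; rewrite ?tnthS ?tnth0.
Qed.

Lemma coord_rotationS d (j : 'I_d) (a : R) (p : measurableTypeR R * d.-tuple R) :
  coord_rotation (lift ord0 j) a (tcons p) = tcons (p.1, coord_rotation j a p.2).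
Proof.
apply: eq_from_tnth => i; rewrite tnth_coord_rotation.
have [i0 ->|->] := unliftP ord0 i; last by rewrite !tnth0.
by rewrite !tnthS tnth_coord_rotation (inj_eq lift_inj).
Qed.

(** Induction on the dimension with Tonelli's theorem: the head coordinate is integrated innermost
    when it is the rotated one, and otherwise the tail is innermost and the induction hypothesis
    applies to it. *)
Lemma integral_coord_rotation d (j : 'I_d) (a : R) (F : d.-tuple R -> \bar R) :
  0 <= a <= 1 -> (forall x, (0 <= F x)%E) -> measurable_fun setT F ->
  (\int[lebesgue_tuple R d]_x F (coord_rotation j a x) =
   \int[lebesgue_tuple R d]_x F x)%E.
Proof.
move=> a01; elim: d j F => [[]//|d IH] j F F0 mF.
have mFc : measurable_fun setT (fun p => F (@tcons R d p)).
  by apply: measurableT_comp => //; exact: measurable_tcons.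
have mFr : measurable_fun setT (fun x => F (coord_rotation j a x)).
  by apply: measurableT_comp => //; exact: measurable_coord_rotation.
have mFrc : measurable_fun setT (fun p => F (coord_rotation j a (@tcons R d p))).
  exact: (measurableT_comp mFr (@measurable_tcons R d)).
rewrite integral_lebesgue_tupleS// [RHS]integral_lebesgue_tupleS//.
have [j' jE|jE] := unliftP ord0 j.
- apply: (etrans (fubini_tonelli1 _ mFrc (fun p => F0 _))).
  apply/esym; apply: (etrans (fubini_tonelli1 _ mFc (fun p => F0 _))); apply/esym.
  apply: eq_integral => x _; rewrite /fubini_F jE.
  under eq_integral do rewrite coord_rotationS.
  apply: (IH j' (fun t => F (tcons (x, t)))) =>//.
  exact: (measurableT_comp mFc (pair1_measurable x)).
- apply: (etrans (fubini_tonelli2 _ mFrc (fun p => F0 _))).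
  apply/esym; apply: (etrans (fubini_tonelli2 _ mFc (fun p => F0 _))); apply/esym.
  apply: eq_integral => t _; rewrite /fubini_G jE.
  under eq_integral do rewrite coord_rotation0.
  apply: (integral_rotation (F := (fun x => F (tcons (x, t)))) a01) => //.
  exact: (measurableT_comp mFc (pair2_measurable t)).
Qed.

(** Used to discard the face [x_j = 1], which the half-open rotation leaves fixed. *)
Lemma lebesgue_tuple_hyperplane d (j : 'I_d) (c : R) :
  lebesgue_tuple R d [set x | tnth x j = c] = 0%E.
Proof.
pose A (i : 'I_d) : set R := if i == j then [set c] else setT.
rewrite (_ : [set _ | _] = [set x | forall i, A i (tnth x i)]); last first.
  apply/seteqP; split=> x /= => [xj i|/(_ j)]; rewrite /A ?eqxx//.
  by case: eqP => // ->.
rewrite lebesgue_tuple_box; last by move=> i; rewrite /A; case: ifP.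
by rewrite (bigD1 j)//= /A eqxx lebesgue_measure_set1 mul0e.
Qed.

End coordinate_rotation.

(** * Coefficients along an irrelevant coordinate vanish *)

Section vanishing_coefficients.
Context (R : realType) (d : nat).

Lemma cosBz2pi (y : R) (z : int) : cos (y - 2 * pi * z%:~R) = cos y.
Proof.
have h (x : R) (m : nat) : cos (x + 2 * pi * m%:R) = cos x.
  by rewrite [2 * pi]mulr_natl mulr_natr (periodicn (@cosD2pi R)).
case: z => m; last by rewrite NegzE mulrNz mulrN opprK; exact: h.
by rewrite -(h _ m) subrK.
Qed.

Lemma sinBz2pi (y : R) (z : int) : sin (y - 2 * pi * z%:~R) = sin y.
Proof.
have h (x : R) (m : nat) : sin (x + 2 * pi * m%:R) = sin x.
  by rewrite [2 * pi]mulr_natl mulr_natr (periodicn (@sinD2pi R)).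
case: z => m; last by rewrite NegzE mulrNz mulrN opprK; exact: h.
by rewrite -(h _ m) subrK.
Qed.

(* A translation of [x_j] by [1 / (2 |k_j|)] changes the phase by half a
   period. *)
Lemma phi_coord_rotation (k : d.-tuple int) (j : 'I_d) (x : d.-tuple R) :
  tnth k j != 0 -> 0 <= tnth x j < 1 ->
  phi k (coord_rotation j (2 * `|(tnth k j)%:~R|)^-1 x) = - phi k x.
Proof.
move=> kj0 xj; set a := _^-1.
have kjR : (tnth k j)%:~R != 0 :> R by rewrite intr_eq0.
(* [s] is the sign of [k_j]; the phase moves by [pi * s], and either sign reverses both cosine and
   sine. *)
have [s [s1 sa]] : exists s : R, (s = 1 \/ s = -1) /\ (tnth k j)%:~R * a = s / 2.
  exists (Num.sg (tnth k j)%:~R); split.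
    by case: (ltgtP (tnth k j)%:~R 0) kjR => // h _;
      [right; rewrite ltr0_sg|left; rewrite gtr0_sg].
  rewrite /a [X in X * _](numEsg (tnth k j)%:~R); field.
  by rewrite normr_eq0.
(* [z] is 0 without wrap-around and [k_j] with it; being an integer, it only contributes full
   periods. *)
have [z dz] : exists z : int,
    dotz k (coord_rotation j a x) = dotz k x + s / 2 - z%:~R.
  have [z rz] : exists z : int,
      (tnth k j)%:~R * rotation a (tnth x j) =
      (tnth k j)%:~R * tnth x j + s / 2 - z%:~R.
    rewrite /rotation; case: ifPn => [_|h].
      by exists 0; rewrite mulrDr sa subr0.
    rewrite ifT; last by move: h; rewrite negb_and -ltNge -leNgt; lra.
    by exists (tnth k j); rewrite !mulrDr sa mulrN mulr1.
  exists z; rewrite /dotz (bigD1 j)//= [in RHS](bigD1 j)//=.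
  rewrite tnth_coord_rotation eqxx rz.
  rewrite (eq_bigr (fun i => (tnth k i)%:~R * tnth x i)); first by ring.
  by move=> i ij; rewrite tnth_coord_rotation (negbTE ij).
have kF : [forall i, tnth k i == 0] = false by apply: contraNF kj0 => /forallP->.
rewrite /phi kF dz.
have -> : 2 * pi * (dotz k x + s / 2 - z%:~R) =
    2 * pi * dotz k x + pi * s - 2 * pi * z%:~R by field.
case: ifP => _; rewrite (cosBz2pi, sinBz2pi) -mulrN; congr (_ * _).
  by case: s1 => ->; rewrite ?mulr1 ?mulrN1 ?cosDpi//
    cosB cospi sinpi mulr0 addr0 mulrN1.
by case: s1 => ->; rewrite ?mulr1 ?mulrN1 ?sinDpi//
  sinB cospi sinpi mulr0 subr0 mulrN1.
Qed.

(** A half-period rotation of coordinate [j] preserves the measure and [f] but reverses [phi k].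
    Hence the positive and negative parts of the integrand have equal integrals. *)
Lemma theta_eq0 (f : d.-tuple R -> R) (k : d.-tuple int) (j : 'I_d) :
  measurable_fun setT f ->
  (forall x y : d.-tuple R, (forall i, i != j -> tnth x i = tnth y i) -> f x = f y) ->
  tnth k j != 0 -> theta f k = 0.
Proof.
move=> mf fj kj0.
pose a : R := (2 * `|(tnth k j)%:~R|)^-1.
have a01 : 0 <= a <= 1.
  have k1 : 1 <= `|(tnth k j)%:~R| :> R.
    by rewrite -intr_norm ler1z -gtz0_ge1 normr_gt0.
  rewrite /a invr_ge0 mulr_ge0//= invf_le1; last by nra.
  lra.
pose G := (fun x => f x * phi k x) \_ (unit_cube R d).
have mG : measurable_fun setT G.
  apply/(measurable_restrictT _ _).1; first exact: measurable_unit_cube.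
  by apply/measurable_funTS/measurable_funM => //; exact: measurable_phi.
have rotG x : tnth x j != 1 -> G (coord_rotation j a x) = - G x.
  move=> xj1; rewrite /G !patchE.
  have rot01 y : y != 1 -> (0 <= rotation a y <= 1) = (0 <= y <= 1).
    rewrite /rotation => y1; have {}y1 : (y < 1) || (1 < y) by rewrite -neq_lt.
    by case: ifPn => h; [|case: ifPn => h']; apply/idP/idP; lra.
  have cubeE : unit_cube R d (coord_rotation j a x) = unit_cube R d x.
    apply/propext; split=> xc i; have := xc i; rewrite tnth_coord_rotation;
      by case: eqP => [ij|]//; rewrite rot01// ij.
  rewrite (_ : (coord_rotation j a x \in unit_cube R d) =
      (x \in unit_cube R d)); last first.
    by apply/idP/idP; rewrite !inE cubeE.
  case: ifPn => xc; last by rewrite oppr0.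
  have xj : 0 <= tnth x j < 1.
    by move: xc; rewrite inE => /(_ j) /andP[-> h]; rewrite lt_neqAle xj1.
  rewrite phi_coord_rotation// mulrN; congr (- (_ * _)).
  by apply: fj => i ij; rewrite tnth_coord_rotation (negbTE ij).
have mmax (h : d.-tuple R -> R) : measurable_fun setT h ->
    measurable_fun setT (fun x => (Num.max (h x) 0)%:E).
  by move=> mh; apply/measurable_EFinP; exact: measurable_maxr.
have GE : (\int[lebesgue_tuple R d]_x (Num.max (G x) 0)%:E =
           \int[lebesgue_tuple R d]_x (Num.max (- G x) 0)%:E)%E.
  rewrite -(@integral_coord_rotation _ _ j a
    (fun x => (Num.max (G x) 0)%:E))//; last 2 first.
  - by move=> x; rewrite lee_fin le_max lexx orbT.
  - exact: mmax.
  apply: ae_eq_integral => //.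
  - apply: (measurableT_comp (mmax _ mG)); exact: measurable_coord_rotation.
  - by apply: mmax; exact: measurable_funN.
  - exists [set x | tnth x j = 1]; split.
    + rewrite -[X in measurable X]setTI.
      exact: (@measurable_tnth _ R d j measurableT _ (measurable_set1 1)).
    + exact: lebesgue_tuple_hyperplane.
    + move=> x /= h; apply/eqP; apply: contra_notT h => xj _.
      by rewrite rotG.
rewrite /theta /Rintegral integral_mkcond integralE.
rewrite (eq_integral (fun x => (Num.max (G x) 0)%:E)); last first.
  by move=> x _; rewrite funeposE EFin_max; congr maxe; rewrite /G !patchE; case: ifP.
rewrite GE [X in fine (_ - X)](eq_integral (fun x => (Num.max (- G x) 0)%:E)).
  (* The common value is not known to be finite; if it is infinite, the difference is infinite and
     [fine] sends it to 0. *)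
  by case: (integral _ _ _) => [r| |]//; rewrite -EFinN -EFinD subrr.
move=> x _; rewrite funenegE EFin_max; congr maxe.
by rewrite EFinN /G !patchE; case: ifP.
Qed.

End vanishing_coefficients.

(** * Lattice points and the deterministic sparsity bound *)

Section lattice_points.
Context (R : realType).

Lemma norm2_ge0 d (k : d.-tuple int) : 0 <= norm2 k :> R.
Proof. exact: sqrtr_ge0. Qed.

Lemma sqr_norm2 d (k : d.-tuple int) :
  norm2 k ^+ 2 = \sum_(i < d) (tnth k i)%:~R ^+ 2 :> R.
Proof. by rewrite sqr_sqrtr// sumr_ge0// => i _; exact: sqr_ge0. Qed.

Lemma le_norm2 d (k : d.-tuple int) i : `|(tnth k i)%:~R| <= norm2 k :> R.
Proof.
rewrite -ler_sqr ?nnegrE ?norm2_ge0// sqr_norm2 real_normK ?num_real//.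
by rewrite (bigD1 i)//= lerDl sumr_ge0// => l _; exact: sqr_ge0.
Qed.

(* A code lists [l] pairs (coordinate, shifted value); all coordinates not
   listed are zero. *)
Definition lattice_point d l M (c : {ffun 'I_l -> 'I_d * 'I_(M.*2.+1)}) :
    d.-tuple int :=
  [tuple (if [pick i | (c i).1 == j] is Some i then (c i).2%:Z - M%:Z else 0)
   | j < d].

Lemma lattice_point_surj d l (m : R) (k : d.-tuple int) :
  (0 < d)%N -> norm2 k <= m -> (norm0 k <= l)%N ->
  exists c, @lattice_point d l (Num.truncn m) c = k.
Proof.
move=> d0 km kl; set M := Num.truncn m.
have kM j : (`|tnth k j| <= M)%N.
  rewrite truncn_ge_nat ?(le_trans (norm2_ge0 k))// -[_%:R]/(`|tnth k j|%N%:~R).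
  by rewrite abszE intr_norm (le_trans (le_norm2 _ _)).
have kMb j : (`|(tnth k j + M%:Z)%R| < M.*2.+1)%N by have := kM j; lia.
pose s := enum [set j | tnth k j != 0].
pose ci (i : 'I_l) := nth (Ordinal d0) s i.
(* The first slots list the support of [k]. Slots beyond it repeat the coordinate [Ordinal d0] with
   its true value, so overlapping entries never disagree. *)
exists [ffun i => (ci i, Ordinal (kMb (ci i)))].
apply: eq_from_tnth => j; rewrite tnth_mktuple; case: pickP => [i|no].
  by rewrite ffunE/= => /eqP->; have := kM j; lia.
apply/esym/eqP/negPn/negP => kj.
have js : j \in s by rewrite mem_enum inE.
have lt : (index j s < l)%N.
  by apply: leq_trans kl; rewrite /norm0 cardE index_mem.
have := no (Ordinal lt); rewrite ffunE /= /ci nth_index// eqxx.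
by [].
Qed.

Lemma finite_norm2_ball d (m : R) : finite_set [set k : d.-tuple int | norm2 k <= m].
Proof.
case: d => [|d].
  apply: (sub_finite_set (B := [set [tuple]])); last exact: finite_set1.
  by move=> k _ /=; rewrite tuple0.
apply: (sub_finite_set (B := range (@lattice_point d.+1 d.+1 (Num.truncn m)))).
  move=> k /= /(@lattice_point_surj _ d.+1 _ _ (ltn0Sn d))[|c <-]; last by exists c.
  by rewrite /norm0 (leq_trans (max_card _))// card_ord.
exact/finite_image/finite_finset.
Qed.

Lemma size_fset_set_le (T1 T2 : choiceType) (A : set T1) (B : set T2) (h : T1 -> T2) :
  finite_set A -> finite_set B -> (forall x, A x -> B (h x)) ->
  (forall x y, A x -> A y -> h x = h y -> x = y) ->
  (size (finmap.enum_fset (fset_set A)) <= size (finmap.enum_fset (fset_set B)))%N.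
Proof.
move=> fA fB AB hinj; rewrite -(size_map h); apply: uniq_leq_size.
  rewrite map_inj_in_uniq ?finmap.fset_uniq// => x y.
  by rewrite !in_fset_set// !inE; exact: hinj.
move=> _ /mapP[x xA ->]; rewrite in_fset_set// inE; apply: AB.
by move: xA; rewrite in_fset_set// inE.
Qed.

(** A point supported in [J] is repacked into the first [#|J|] of [l] coordinates and padded with
    zeros, which is injective and keeps the norm. Listing [j] first makes [k_j] the head coordinate
    tested by [lattice_count]. *)
Lemma lattice_count_ge d l (J : {set 'I_d}) (j : 'I_d) (gamma : R) :
  j \in J -> (#|J| <= l)%N ->
  (size (finmap.enum_fset (fset_set
     [set k : d.-tuple int | [/\ tnth k j != 0, norm2 k ^+ 2 <= gamma * l%:R
       & forall i, i \notin J -> tnth k i = 0]%R]))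
   <= lattice_count l gamma)%N.
Proof.
move=> jJ Jl; pose s := j :: enum (J :\ j).
have us : uniq s by rewrite /= enum_uniq mem_enum !inE eqxx.
have sJ i : (i \in s) = (i \in J).
  by rewrite inE mem_enum !inE; case: eqP => [->|].
have sl : (size s <= l)%N by rewrite /= -cardE (cardsD1 j J) jJ in Jl *.
pose h (k : d.-tuple int) : l.-tuple int :=
  [tuple if (i < size s)%N then tnth k (nth j s i) else 0 | i < l].
have hnorm k : (forall i, i \notin J -> tnth k i = 0) ->
    norm2 (h k) ^+ 2 = norm2 k ^+ 2 :> R.
  move=> kJ; rewrite !sqr_norm2.
  rewrite (bigID (mem J))/= [X in _ = _ + X]big1 ?addr0; last first.
    by move=> i iJ; rewrite kJ// expr0n.
  rewrite (eq_bigl (mem s)); last by move=> i; rewrite /= sJ.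
  rewrite -big_uniq//= (big_nth j) big_mkord.
  rewrite (big_ord_widen _ (fun i => (tnth k (nth j s i))%:~R ^+ 2) sl).
  rewrite [RHS]big_mkcond.
  by apply: eq_bigr => i _; rewrite tnth_mktuple; case: ifP; rewrite ?expr0n.
have ball n (A : set (n.-tuple int)) :
    (forall k, A k -> norm2 k ^+ 2 <= gamma * l%:R) -> finite_set A.
  move=> Ab.
  apply: (sub_finite_set _ (@finite_norm2_ball n (Num.sqrt (gamma * l%:R)))).
  move=> k /Ab kb /=; have g0 := le_trans (sqr_ge0 _) kb.
  rewrite -ler_sqr ?nnegrE ?norm2_ge0 ?sqrtr_ge0// [leRHS]sqr_sqrtr//.
apply: (@size_fset_set_le _ _ _ _ h).
- by apply: ball => k [].
- by apply: ball => k [].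
- move=> k [kj kn kJ]; split; first by rewrite hnorm.
  case: l Jl sl @h {hnorm ball kn} => [|l] Jl sl h; first by rewrite leqn0 in sl.
  have -> : head 0 (h k) = tnth (h k) ord0 by rewrite (tnth_nth 0) -nth0.
  by rewrite tnth_mktuple.
- move=> k k' [_ _ kJ] [_ _ kJ'] hk; apply: eq_from_tnth => i.
  have [iJ|iJ] := boolP (i \in J); last by rewrite kJ ?kJ'.
  have is_ : (index i s < size s)%N by rewrite index_mem sJ.
  have := congr1 (fun t => tnth t (Ordinal (leq_trans is_ sl))) hk.
  by rewrite !tnth_mktuple is_ nth_index ?sJ.
Qed.

End lattice_points.

(** * Low-frequency energy at a relevant coordinate *)

Section sparsity.
Context (R : realType) (d dstar : nat) (kappa L : R) (f : d.-tuple R -> R).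
Variable J : {set 'I_d}.
Hypotheses (dstar_gt0 : (0 < dstar)%N) (kappa_gt0 : 0 < kappa) (L_gt0 : 0 < L).
Hypotheses (f_meas : measurable_fun setT f) (HC2 : C2 dstar kappa L f J).

Lemma theta_outside_sparsity_eq0 (k : d.-tuple int) j :
  j \notin J -> tnth k j != 0 -> theta f k = 0.
Proof.
move=> jJ; apply: theta_eq0 => // x y xy.
have [_ _ [fbar fE] _] := HC2; rewrite !fE; congr fbar.
apply: eq_from_tnth => i; rewrite !tnth_mktuple; apply: xy.
by apply: contraNneq jJ => <-; exact: enum_valP.
Qed.

(** A nonzero integer [k_j] has [k_j^2 >= 1], so [Qj f j] is at most the weighted sum bounded by
    [L]. *)
Lemma kappa_le_L j : j \in J -> kappa <= L.
Proof.
move=> jJ; have [SL _ _ /(_ _ jJ) kQ] := HC2.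
rewrite -lee_fin; apply: le_trans kQ _; apply: le_trans (SL j).
rewrite /Qj esum_mkcond; apply: le_esum => k _; rewrite -[k \in _]/(`[< _ >]).
case: asboolP => /= [kj|_]; last by rewrite lee_fin mulr_ge0 ?sqr_ge0.
rewrite lee_fin ler_peMl ?sqr_ge0// -(real_normK (num_real _)).
by rewrite expr_ge1// -intr_norm ler1z -gtz0_ge1 normr_gt0.
Qed.

Lemma energy_le (F : seq (d.-tuple int)) i : uniq F ->
  \sum_(k <- F) (tnth k i)%:~R ^+ 2 * theta f k ^+ 2 <= L.
Proof.
move=> uF; rewrite -lee_fin; have [SL _ _ _] := HC2.
apply: le_trans (SL i); apply: esum_ge; exists [set` F].
  by split=> //; exact: finite_seq.
by rewrite -fsbig_seq// sumEFin.
Qed.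

Lemma sum_lt_cst (T : eqType) (s : seq T) (a : T -> R) (t : R) :
  s != [::] -> {in s, forall x, a x < t} -> \sum_(x <- s) a x < (size s)%:R * t.
Proof.
elim: s => // x s IH _ H; rewrite big_cons /= -natr1 mulrDl mul1r addrC.
have [->|s0] := eqVneq s [::].
  by rewrite big_nil add0r mul0r add0r H ?inE ?eqxx.
apply: ltrD; last by apply: H; rewrite inE eqxx.
by apply: IH => // y ys; apply: H; rewrite inE ys orbT.
Qed.

Lemma kappa_lt_count (j : 'I_d) (t : R) : j \in J -> 0 <= t ->
  (forall k, norm2 k <= Num.sqrt (2 * L * dstar%:R / kappa) ->
    (norm0 k <= dstar)%N -> tnth k j != 0 -> `|theta f k| < t) ->
  kappa < 2 * (lattice_count dstar (2 * L / kappa))%:R * t ^+ 2.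
Proof.
move=> jJ t0 small; have [_ Jd _ /(_ _ jJ) kQ] := HC2.
have m20 : 0 < 2 * L * dstar%:R / kappa.
  by rewrite divr_gt0// !mulr_gt0// ltr0n.
have m2E : 2 * L / kappa * dstar%:R = 2 * L * dstar%:R / kappa by rewrite mulrAC.
set m := Num.sqrt _ in small.
have mE : m ^+ 2 = 2 * L * dstar%:R / kappa by rewrite sqr_sqrtr// ltW.
set S := [set k : d.-tuple int | [/\ tnth k j != 0%R,
  norm2 k ^+ 2 <= 2 * L / kappa * dstar%:R & forall i, i \notin J -> tnth k i = 0%R]].
have SN := lattice_count_ge (2 * L / kappa) jJ Jd; rewrite -/S in SN.
have norm_le k : (norm2 k <= m) = (norm2 k ^+ 2 <= 2 * L / kappa * dstar%:R).
  by rewrite -ler_sqr ?nnegrE ?norm2_ge0 ?sqrtr_ge0// mE m2E.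
have fS : finite_set S.
  apply: (sub_finite_set _ (@finite_norm2_ball R d m)) => k [_ + _] /=.
  by rewrite norm_le.
(* Outside [S], a nonzero coefficient has [k] supported in [J] and norm above [m], so [m^2 theta^2]
   is at most the sum over [i] in [J] of [k_i^2 theta^2]. Summing over [k] gives at most
   [dstar * L], and division by [m^2] gives [kappa / 2]. *)
have tail : (\esum_(k in [set k : d.-tuple int | tnth k j != 0%R] `&` ~` S)
    (theta f k ^+ 2)%:E <= (kappa / 2)%:E)%E.
  apply: ge_ereal_sup => _ [F [fF FS] <-].
  rewrite fsbig_finite//= sumEFin lee_fin.
  set s := finmap.enum_fset _.
  have us : uniq s by exact: finmap.fset_uniq.
  have : \sum_(k <- s) theta f k ^+ 2 * m ^+ 2 <=
      \sum_(k <- s) \sum_(i in J) (tnth k i)%:~R ^+ 2 * theta f k ^+ 2.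
    rewrite big_seq [leRHS]big_seq; apply: ler_sum => k.
    rewrite in_fset_set// inE => /FS[/= kj kS].
    have [->|th0] := eqVneq (theta f k) 0.
      rewrite expr0n/= mul0r sumr_ge0// => i _; by rewrite mulr0.
    have kJ i : i \notin J -> tnth k i = 0.
      move=> iJ; apply/eqP; apply: contraNT th0 => ki.
      by rewrite (theta_outside_sparsity_eq0 iJ ki).
    rewrite -mulr_suml mulrC ler_wpM2r ?sqr_ge0//.
    have -> : \sum_(i in J) (tnth k i)%:~R ^+ 2 = norm2 k ^+ 2 :> R.
      rewrite sqr_norm2 [RHS](bigID (mem J))/= [X in _ = _ + X]big1 ?addr0//.
      by move=> i iJ; rewrite kJ// expr0n.
    rewrite leNgt; apply/negP => km; apply: kS; split=> //.
    by rewrite m2E -mE ltW.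
  rewrite -mulr_suml exchange_big/= => le1.
  have le2 : \sum_(i in J) \sum_(k <- s) (tnth k i)%:~R ^+ 2 * theta f k ^+ 2 <=
      dstar%:R * L.
    apply: (@le_trans _ _ (\sum_(i in J) L)).
      by apply: ler_sum => i _; exact: energy_le.
    by rewrite sumr_const -[leLHS]mulr_natl ler_wpM2r ?ler_nat// ltW.
  have := le_trans le1 le2; rewrite -ler_pdivlMr ?mE// => /le_trans; apply.
  rewrite le_eqVlt; apply/orP; left; apply/eqP; field.
  by rewrite !gt_eqF// ltr0n.
have head_ge : kappa / 2 <= \sum_(k <- finmap.enum_fset (fset_set S)) theta f k ^+ 2.
  have : (kappa%:E <= (\sum_(k <- finmap.enum_fset (fset_set S)) theta f k ^+ 2)%:E
      + (kappa / 2)%:E)%E.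
    apply: le_trans kQ _; rewrite /Qj (esumID S)//; last first.
      by move=> k _; rewrite lee_fin sqr_ge0.
    apply: leeD => //; rewrite (_ : _ `&` S = S); last first.
      by apply/seteqP; split=> [k []//|k Sk]; split=> //; case: Sk.
    rewrite esum_fset//; last by move=> k _; rewrite lee_fin sqr_ge0.
    by rewrite fsbig_finite//= sumEFin.
  by rewrite -EFinD lee_fin; lra.
set s := finmap.enum_fset _ in SN head_ge.
(* Positive energy on [S] makes it nonempty, which the strict inequality of [sum_lt_cst]
   requires. *)
have s0 : s != [::].
  by apply/eqP => s0; move: head_ge; rewrite s0 big_nil leNgt divr_gt0.
have : \sum_(k <- s) theta f k ^+ 2 < (size s)%:R * t ^+ 2.
  apply: sum_lt_cst => // k; rewrite in_fset_set// inE => -[kj kn kJ].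
  rewrite -(real_normK (num_real (theta f k))) ltr_sqr ?nnegrE//.
  apply: small => //; first by rewrite norm_le.
  apply: leq_trans Jd; apply: subset_leq_card; apply/fintype.subsetP => i.
  by rewrite inE; apply: contraNT => /kJ->.
have : (size s)%:R * t ^+ 2 <= (lattice_count dstar (2 * L / kappa))%:R * t ^+ 2.
  by rewrite ler_wpM2r ?sqr_ge0// ler_nat.
lra.
Qed.

End sparsity.

(** * Consistency of the selection *)

Lemma probability_bigsetU_le (R : realType) disp (T : measurableType disp)
    (P : probability T R) (I : Type) (r : seq I) (A : I -> set T) (e : R) :
  (forall i, measurable (A i)) -> (forall i, (P (A i) <= e%:E)%E) ->
  (P (\big[setU/set0]_(i <- r) A i) <= ((size r)%:R * e)%:E)%E.
Proof.
move=> mA Ae; elim: r => [|i r IH]; first by rewrite big_nil measure0 mul0r.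
rewrite big_cons; apply: le_trans (measureU2 _ _ _) _ => //.
  exact: bigsetU_measurable.
by rewrite /= -natr1 mulrDl mul1r addrC EFinD leeD.
Qed.

Lemma mem_J_hat (R : realType) (d n : nat) (g : d.-tuple R -> R)
    (x : 'I_n -> d.-tuple R) (y : 'I_n -> R) (l : nat) (m lambda : R) j :
  reflect (exists k : d.-tuple int, [/\ norm2 k <= m, (norm0 k <= l)%N,
      tnth k j != 0 & lambda < `|theta_hat g x y k| ])
    (j \in J_hat g x y l m lambda).
Proof. by rewrite /J_hat finset.inE; exact: asboolP. Qed.

(** Selection of [j] is a finite union of threshold events, since a ball contains finitely many
    lattice points; a wrong selection is a finite union over [j] of such events or their
    complements. *)
Lemma measurable_J_hat_neq (R : realType) (d n : nat) disp
    (T : measurableType disp) (P : probability T R)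
    (X : 'I_n -> {RV P >-> d.-tuple R}) (Y : 'I_n -> {RV P >-> R})
    (g : d.-tuple R -> R) (l : nat) (m lambda : R) (J : {set 'I_d}) :
  (forall k, measurable_fun setT (fun w => theta_hat g (X^~ w) (Y^~ w) k)) ->
  measurable [set w | J_hat g (X^~ w) (Y^~ w) l m lambda != J].
Proof.
move=> mth.
pose B (j : 'I_d) := [set w | j \in J_hat g (X^~ w) (Y^~ w) l m lambda].
have mB j : measurable (B j).
  rewrite (_ : B j = \bigcup_(k in [set k : d.-tuple int |
      [/\ norm2 k <= m, (norm0 k <= l)%N & tnth k j != 0]])
      ((fun w => `|theta_hat g (X^~ w) (Y^~ w) k|) @^-1` `]lambda, +oo[)).
    apply: fin_bigcup_measurable => [|k _].
      by apply: sub_finite_set (@finite_norm2_ball R d m) => k [].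
    rewrite -[X in measurable X]setTI.
    have mabs : measurable_fun setT (fun w => `|theta_hat g (X^~ w) (Y^~ w) k|).
      by apply: measurableT_comp.
    by apply: mabs.
  apply/seteqP; split=> w /=.
    by move=> /mem_J_hat[k [km kl kj lk]]; exists k => //=; rewrite in_itv/= andbT.
  by move=> [k /= [km kl kj]]; rewrite in_itv/= andbT => lk; apply/mem_J_hat; exists k.
rewrite (_ : [set _ | _] = \bigcup_(j in [set: 'I_d])
    (if j \in J then ~` B j else B j)).
  apply: fin_bigcup_measurable => [|j _]; first exact: finite_finset.
  by case: ifP => _ //; exact: measurableC.
apply/seteqP; split=> w /=.
  move=> neq; apply: contrapT => no; move/negP: neq; apply; apply/eqP/setP => j.
  apply: contrapT => jne; apply: no; exists j => //; case: ifP => jJ.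
    by move=> h; apply: jne; rewrite jJ; exact: h.
  apply/negPn/negP => h; apply: jne; rewrite jJ; exact/negbTE.
move=> [j _]; case: ifP => [jJ|jJ] h; apply/eqP => E; move: h; rewrite /B/= E jJ//.
Qed.

Theorem theorem1 (R : realType) (d dstar n : nat)
  (disp : measure_display) (T : measurableType disp) (P : probability T R)
  (X : 'I_n -> {RV P >-> d.-tuple R}) (Y eps : 'I_n -> {RV P >-> R})
  (f g : d.-tuple R -> R) (J : {set 'I_d})
  (sigma gmin kappa L Linf L2 : R)
  (dstar_ge1 : (1 <= dstar)%N) (dstar_le : (dstar <= d)%N) (n_ge1 : (1 <= n)%N)
  (sigma_ge0 : 0 <= sigma) (gmin_gt0 : 0 < gmin)
  (kappa_gt0 : 0 < kappa) (L_gt0 : 0 < L) (Linf_gt0 : 0 < Linf) (L2_ge0 : 0 <= L2)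
  (f_meas : measurable_fun setT f)
  (indep : mutually_independent P (fun i w => (X i w, Y i w)))
  (ident : identically_distributed P (fun i w => (X i w, Y i w)))
  (model : forall i w, Y i w = f (X i w) + sigma * eps i w)
  (noise : forall i, is_cond_expectation P (X i) (eps i) (fun=> 0))
  (density : forall i, has_density (X i) g)
  (HC1 : C1 gmin g)
  (HC2 : C2 dstar kappa L f J)
  (HC3 : forall i, C3 (X i) Linf L2 f g)
  (HC4 : forall i, C4 (X i) (eps i)) :
  let m := Num.sqrt (2 * L * dstar%:R / kappa) in
  let logt := ln (6 * m * d%:R) in
  let lambda :=
    4 * (sigma + L2) * Num.sqrt (dstar%:R * logt / (n%:R * gmin ^+ 2)) in
  Linf ^+ 2 * dstar%:R * logt / n%:R <= L2 ^+ 2 ->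
  128 * (sigma + L2) ^+ 2 * dstar%:R * (lattice_count dstar (2 * L / kappa))%:R
    * logt / (n%:R * gmin ^+ 2) <= kappa ->
  (P [set w | J_hat g (X^~ w) (Y^~ w) dstar m lambda != J]
     <= (3 * (6 * m * d%:R) ^- dstar)%:E)%E.
Proof.
move=> m logt lambda hyp1 hyp2.
have d_gt0 : (0 < d)%N by exact: leq_trans dstar_le.
have m2 : m ^+ 2 = 2 * L * dstar%:R / kappa.
  by rewrite sqr_sqrtr// divr_ge0 ?mulr_ge0// ltW.
have m_ge0 : 0 <= m by exact: sqrtr_ge0.
have B0 : 0 <= 6 * m * d%:R by rewrite !mulr_ge0.
(* A nonempty [J] would give [kappa <= L] and thus [m >= 1]; a selected index would give an integer
   vector with a nonzero coordinate and norm below 1. *)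
have [m1|m1] := ltP m 1.
  have J0 : J = finset.set0.
    apply/eqP; apply: contraT => /set0Pn[j jJ].
    have kL := kappa_le_L HC2 jJ.
    suff : 1 <= m ^+ 2 by rewrite expr_ge1// leNgt m1.
    rewrite m2 ler_pdivlMr// mul1r (le_trans kL)//.
    have : 1 <= dstar%:R :> R by rewrite ler1n.
    by nra.
  rewrite (_ : [set _ | _] = set0) ?measure0 ?lee_fin ?mulr_ge0 ?invr_ge0 ?exprn_ge0//.
  apply/seteqP; split=> // w /= /eqP; apply; rewrite J0; apply/setP => j.
  rewrite finset.in_set0; apply/negP => /mem_J_hat[k [km _ kj _]].
  have := le_lt_trans (le_trans (le_norm2 R k j) km) m1.
  by rewrite ltNge -intr_norm ler1z -gtz0_ge1 normr_gt0 kj.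
have d1 : 1 <= d%:R :> R by rewrite ler1n.
have dstar1 : 1 <= dstar%:R :> R by rewrite ler1n.
have n0 : 0 < n%:R :> R by rewrite ltr0n.
set B := 6 * m * d%:R in logt lambda hyp1 hyp2 B0 *.
have B6 : 6 <= B by rewrite /B; nra.
have logt0 : 0 < logt by rewrite ln_gt0//; lra.
have expB : expR logt = B by rewrite lnK// posrE; lra.
pose a := dstar%:R * logt / n%:R.
have a0 : 0 < a by rewrite divr_gt0// mulr_gt0//; lra.
pose q := Num.sqrt a.
have q0 : 0 < q by rewrite sqrtr_gt0.
have q2 : q ^+ 2 = a by rewrite sqr_sqrtr// ltW.
(* The square root of the first assumption; it keeps [s] in the range where the exponential moment
   bound holds. *)
have Lq : Linf * q <= L2.
  rewrite -ler_sqr ?nnegrE ?mulr_ge0 ?(ltW q0) ?(ltW Linf_gt0)//.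
  by rewrite exprMn q2 /a !mulrA.
have L20 : 0 < L2 by apply: lt_le_trans Lq; rewrite mulr_gt0.
pose sg := sigma + L2.
have sg0 : 0 < sg by rewrite /sg; lra.
have lambdaE : lambda = 4 * sg * (q / gmin).
  rewrite /lambda -/sg invfM mulrA -/a sqrtrM ?(ltW a0)// -exprVn sqrtr_sqr.
  by rewrite ger0_norm// invr_ge0 ltW.
have lambda0 : 0 < lambda by rewrite lambdaE mulr_gt0 ?divr_gt0 ?mulr_gt0.
pose s := gmin * q / sg.
have s0 : 0 < s by rewrite divr_gt0// mulr_gt0.
have sqrt2 : Num.sqrt 2 <= 3 / 2 :> R.
  by rewrite -ler_sqr ?nnegrE ?sqrtr_ge0 ?divr_ge0// sqr_sqrtr//; lra.
have s_le : s * (Num.sqrt 2 * Linf / gmin) <= 3 / 2.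
  apply: le_trans sqrt2.
  rewrite (_ : s * _ = Num.sqrt 2 * ((Linf * q) / sg)); last first.
    by rewrite /s; field; rewrite !gt_eqF.
  rewrite ler_piMr ?sqrtr_ge0// ler_pdivrMr// mul1r (le_trans Lq)// /sg; lra.
(* Here [s * lambda = 4 q^2], while [sigma^2 + 2 L2^2 <= 2 (sigma + L2)^2] gives at most [2 q^2] for
   the variance term; the difference [- 2 q^2] times [n] is the right-hand side. *)
have exponent : n%:R * (s ^+ 2 * ((sigma ^+ 2 + 2 * L2 ^+ 2) / gmin ^+ 2) - s * lambda)
    <= - ((dstar.*2)%:R * logt).
  have -> : (dstar.*2)%:R * logt = n%:R * (2 * q ^+ 2).
    by rewrite q2 /a -muln2 natrM; field; rewrite gt_eqF.
  rewrite -[leRHS]mulrN ler_pM2l// lambdaE.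
  have -> : s * (4 * sg * (q / gmin)) = 4 * q ^+ 2.
    by rewrite /s; field; rewrite !gt_eqF.
  have -> : s ^+ 2 * ((sigma ^+ 2 + 2 * L2 ^+ 2) / gmin ^+ 2) =
      q ^+ 2 * ((sigma ^+ 2 + 2 * L2 ^+ 2) / sg ^+ 2).
    by rewrite /s; field; rewrite !gt_eqF.
  have : (sigma ^+ 2 + 2 * L2 ^+ 2) / sg ^+ 2 <= 2.
    by rewrite ler_pdivrMr ?exprn_gt0// /sg; nra.
  have := sqr_ge0 q; nra.
(* The union bound runs over codes, which cover all of [S_(m,dstar)] and are easily counted;
   repeated points do no harm. *)
pose code := {ffun 'I_dstar -> 'I_d * 'I_((Num.truncn m).*2.+1)}.
pose bad (c : code) := [set w |
  lambda <= `|theta_hat g (X^~ w) (Y^~ w) (lattice_point c)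
              - theta f (lattice_point c)|].
have mth k : measurable_fun setT (fun w => theta_hat g (X^~ w) (Y^~ w) k).
  exact: (measurable_theta_hat _ n_ge1 density).
have mbad c : measurable (bad c).
  rewrite (_ : bad c = (fun w => `|theta_hat g (X^~ w) (Y^~ w) (lattice_point c) -
      theta f (lattice_point c)|) @^-1` `[lambda, +oo[).
    rewrite -[X in measurable X]setTI.
    have mabs : measurable_fun setT (fun w => `|theta_hat g (X^~ w) (Y^~ w)
        (lattice_point c) - theta f (lattice_point c)|).
      by apply: measurableT_comp => //; apply: measurable_funB.
    by apply: mabs.
  by apply/seteqP; split=> w; rewrite /= in_itv/= andbT.
have Pbad c : (P (bad c) <= (2 * B ^- dstar.*2)%:E)%E.
  apply: le_trans (theta_hat_tail n_ge1 gmin_gt0 f_meas indep model density HC1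
    HC3 HC4 _ lambda s0 s_le) _.
  rewrite lee_fin ler_pM2l//.
  apply: le_trans (_ : expR (- ((dstar.*2)%:R * logt)) <= _).
    by rewrite ler_expR.
  by rewrite expRN expRM_natl expB.
apply: (@le_trans _ _ (P (\big[setU/set0]_(c <- index_enum code) bad c))).
  apply: le_measure; rewrite ?inE.
  - exact: measurable_J_hat_neq.
  - exact: bigsetU_measurable.
  move=> w /= Jneq; rewrite -bigcup_seq; apply: contrapT => good.
  have close k : norm2 k <= m -> (norm0 k <= dstar)%N ->
      `|theta_hat g (X^~ w) (Y^~ w) k - theta f k| < lambda.
    move=> km kd; have [c ck] := lattice_point_surj d_gt0 km kd.
    rewrite ltNge; apply/negP => h; apply: good; exists c.
      by rewrite /= mem_index_enum.
    by rewrite /bad /= ck.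
  move/eqP: Jneq; apply; apply/setP => j; apply/idP/idP.
    move=> /mem_J_hat[k [km kd kj]]; apply: contraTT => jJ.
    have := close _ km kd.
    by rewrite (theta_outside_sparsity_eq0 f_meas HC2 jJ kj) subr0 -leNgt => /ltW.
  move=> jJ; apply/mem_J_hat; apply: contrapT => no.
  have lambda2 : 0 <= 2 * lambda by rewrite mulr_ge0// ltW.
  have small k : norm2 k <= m -> (norm0 k <= dstar)%N -> tnth k j != 0 ->
      `|theta f k| < 2 * lambda.
    move=> km kd kj; have lt := close _ km kd.
    have le : `|theta_hat g (X^~ w) (Y^~ w) k| <= lambda.
      by rewrite leNgt; apply/negP => h; apply: no; exists k.
    move: lt le; rewrite ltr_norml ler_norml ltr_norml; lra.
  have := kappa_lt_count dstar_ge1 kappa_gt0 L_gt0 f_meas HC2 jJ lambda2 small.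
  (* With [t = 2 * lambda] the bound [2 N t^2] equals [8 N lambda^2], and [lambda = 4 sg q / gmin]
     produces the constant [128 = 8 * 16] of the second assumption. *)
  apply/negP; rewrite -leNgt; apply: le_trans hyp2.
  rewrite lambdaE le_eqVlt; apply/orP; left; apply/eqP.
  rewrite !exprMn exprVn q2 /a -/sg; field.
  by rewrite !gt_eqF.
apply: le_trans (probability_bigsetU_le _ mbad Pbad) _.
rewrite lee_fin (_ : size _ = #|{: code}|); last by rewrite cardT enumT.
rewrite card_ffun card_prod !card_ord.
set M := Num.truncn m.
have M1 : (1 <= M)%N by rewrite truncn_gt0.
have Mm : M%:R <= m by rewrite truncn_le.
(* Since [M >= 1], [2 M + 1 <= 3 M <= 3 m], so each slot of a code has at most [3 m d = B / 2]
   values. *)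
have code_le : (d * M.*2.+1)%:R <= B / 2.
  have : (M.*2.+1)%:R <= 3 * m.
    apply: (@le_trans _ _ (3 * M%:R)); last lra.
    by rewrite -natrM ler_nat mulSn mul2n -add1n leq_add2r.
  by rewrite natrM /B; nra.
have Bd : 0 < B ^+ dstar by rewrite exprn_gt0//; lra.
rewrite natrX -(muln2 dstar) exprM.
(* Number of codes times the bound for one code; half the powers of [B] cancel and the remaining
   factor [2 / 2^dstar] is below 3. *)
apply: (@le_trans _ _ ((B / 2) ^+ dstar * (2 * (B ^+ dstar) ^- 2))).
  rewrite ler_wpM2r ?mulr_ge0 ?invr_ge0 ?sqr_ge0// lerXn2r// nnegrE//; lra.
rewrite expr_div_n.
have -> : B ^+ dstar / 2 ^+ dstar * (2 * (B ^+ dstar) ^- 2) =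
    2 / 2 ^+ dstar * B ^- dstar.
  by field; rewrite !gt_eqF// exprn_gt0.
rewrite ler_pM2r ?invr_gt0// ler_pdivrMr ?exprn_gt0//.
have : 1 <= 2 ^+ dstar :> R by rewrite exprn_ege1// ler1n.
lra.
Qed.
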